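(* Let $C,\varrho_0\in\mathbb{R}_{>0}$, $H$ a Hilbert space, and let $\Phi:\bigcap_{\eta>0}H_{\eta,0}(\mathbb{R})\otimes(H\oplus H)\to\bigcap_{\eta>0}H_{\eta,0}(\mathbb{R})\otimes H$ be such that for every $\varrho>\varrho_0$ there is $K>0$ with $$|\Phi(0)|_{\varrho,0}\le K\quad\text{and}\quad|\Phi(u)-\Phi(w)|_{\varrho,0}\le C|u-w|_{\varrho,0}$$ for all $u,w\in\bigcap_{\eta>0}H_{\eta,0}(\mathbb{R})\otimes(H\oplus H)$. Let $\alpha,\beta:\mathbb{R}\to\mathbb{R}$ be bijective, Lipschitz continuous, with bounded measurable derivatives a.e., such that $\alpha(s)\ge s$ and $\beta(s)\ge s+\varepsilon_0$ for some $\varepsilon_0>0$ and all $s\in\mathbb{R}$. For $\varrho>\varrho_0$ let $\Phi_\varrho:H_{\varrho,0}(\mathbb{R})\otimes(H\oplus H)\to H_{\varrho,0}(\mathbb{R})\otimes H$ be the continuous extension of $\Phi$. Then there is $\varrho_1>\varrho_0$ such that for every $\varrho\ge\varrho_1$ the equation $$\partial_{0,\varrho}u=\Phi_\varrho\big(u\circ\alpha^{-1},(\partial_{0,\varrho}u)\circ\beta^{-1}\big)$$ admits a unique solution $u\in H_{\varrho,0}(\mathbb{R})\otimes H$ (with $\partial_{0,\varrho}u\in H_{\varrho,0}(\mathbb{R})\otimes H$, so that the right-hand side is defined). Furthermore, the solution operator is causal, i.e. the mapping $u\mapsto\partial_{0,\varrho}^{-1}\Phi_\varrho(u\circ\alpha^{-1},(\partial_{0,\varrho}u)\circ\beta^{-1})$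 is causal on its domain $\{u\in H_{\varrho,0}(\mathbb{R})\otimes H:\partial_{0,\varrho}u\in H_{\varrho,0}(\mathbb{R})\otimes H\}$.
   Context: For $\varrho\in\mathbb{R}$ and a Hilbert space $X$, $H_{\varrho,0}(\mathbb{R})\otimes X$ is the Hilbert space of (classes of) measurable $f:\mathbb{R}\to X$ with $|f|_{\varrho,0}^2=\int_{\mathbb{R}}|f(t)|_X^2e^{-2\varrho t}dt<\infty$; $H\oplus H$ carries the norm $|(a,b)|^2=|a|_H^2+|b|_H^2$. For $\varrho\ne0$, $\partial_{0,\varrho}$ is the (distributional) derivative in $H_{\varrho,0}(\mathbb{R})\otimes H$ with domain $\{f: f'\in H_{\varrho,0}(\mathbb{R})\otimes H\}$, continuously invertible with inverse $\partial_{0,\varrho}^{-1}$. A mapping $W$ with domain in $H_{\varrho,0}(\mathbb{R})\otimes H$ and values in $H_{\varrho,0}(\mathbb{R})\otimes H$ is causal if for all $a\in\mathbb{R}$ and $x,y$ in its domain, $\chi_{\mathbb{R}_{<a}}(x-y)=0$ implies $\chi_{\mathbb{R}_{<a}}(W(x)-W(y))=0$ (multiplication by the indicator of $(-\infty,a)$). *)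

(* Defs.v *)
From HB Require Import structures.
From mathcomp Require Import all_boot all_order all_algebra.
From mathcomp Require Import all_classical all_reals all_analysis.
Set Implicit Arguments. Unset Strict Implicit. Unset Printing Implicit Defensive.
Import Order.TTheory GRing.Theory Num.Theory.
Import numFieldNormedType.Exports.
Local Open Scope classical_set_scope.
Local Open Scope ring_scope.

Notation leb := (@lebesgue_measure _).

(* A real Hilbert space: a complete normed space (H) whose norm is induced
   by the symmetric bilinear form ip. *)
Definition is_inner_product {R : realType} {H : normedModType R}
  (ip : H -> H -> R) : Prop :=
  [/\ (forall x y z : H, ip (x + y) z = ip x z + ip y z),
      (forall (a : R) (x y : H), ip (a *: x) y = a * ip x y),
      (forall x y : H, ip x y = ip y x) &
      (forall x : H, ip x x = `|x| ^+ 2)].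

Definition simple_fun {R : realType} {H : normedModType R} (g : R -> H) : Prop :=
  finite_set (range g) /\ forall y : H, measurable (g @^-1` [set y]).

Definition smeasurable {R : realType} {H : normedModType R} (f : R -> H) : Prop :=
  exists g : nat -> R -> H, (forall n, simple_fun (g n)) /\
    forall t, g n t @[n --> \oo] --> f t.

Definition rwnorm {R : realType} (rho : R) (f : R -> R) : \bar R :=
  Lnorm leb 2%:E (fun t => (f t * expR (- (rho * t)))%:E).

Definition wnorm {R : realType} {H : normedModType R} (rho : R) (f : R -> H) : \bar R :=
  rwnorm rho (fun t => `|f t|).

Definition wnorm2 {R : realType} {H : normedModType R} (rho : R) (a b : R -> H) : \bar R :=
  rwnorm rho (fun t => Num.sqrt (`|a t| ^+ 2 + `|b t| ^+ 2)).

Definition inL2 {R : realType} {H : normedModType R} (rho : R) (f : R -> H) : Prop :=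
  smeasurable f /\ (wnorm rho f < +oo)%E.

Definition inL2pair {R : realType} {H : normedModType R} (rho : R) (a b : R -> H) : Prop :=
  [/\ smeasurable a, smeasurable b & (wnorm2 rho a b < +oo)%E].

Definition inL2all {R : realType} {H : normedModType R} (f : R -> H) : Prop :=
  forall eta : R, 0 < eta -> inL2 eta f.
Definition inL2pairall {R : realType} {H : normedModType R} (a b : R -> H) : Prop :=
  forall eta : R, 0 < eta -> inL2pair eta a b.

Definition aeq {R : realType} {H : Type} (f g : R -> H) : Prop :=
  {ae leb, forall t, f t = g t}.
Definition aeq_before {R : realType} {H : Type} (a : R) (f g : R -> H) : Prop :=
  {ae leb, forall t, t < a -> f t = g t}.

Definition test_fun {R : realType} (phi : R -> R) : Prop :=
  (forall n x, derivable (iter n (fun g : R -> R => derive1 g) phi) x 1) /\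
  exists M : R, forall x, M < `|x| -> phi x = 0.

Definition weak_deriv {R : realType} {H : normedModType R} (ip : H -> H -> R)
  (u g : R -> H) : Prop :=
  forall (h : H) (phi : R -> R), test_fun phi ->
    (\int[leb]_t (ip (u t) h * derive1 phi t)%:E =
     - \int[leb]_t (ip (g t) h * phi t)%:E)%E.

(* u is in the domain of d_{0,rho} with d_{0,rho} u = g *)
Definition has_deriv {R : realType} {H : normedModType R} (ip : H -> H -> R)
  (rho : R) (u g : R -> H) : Prop :=
  [/\ inL2 rho u, inL2 rho g & weak_deriv ip u g].

Definition fsub {R : realType} {H : normedModType R} (f g : R -> H) : R -> H :=
  fun t => f t - g t.

Definition cont_ext {R : realType} {H : normedModType R} (rho : R)
  (Phi Psi : (R -> H) -> (R -> H) -> (R -> H)) : Prop :=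
  [/\ (forall a b, inL2pair rho a b -> inL2 rho (Psi a b)),
      (forall a b, inL2pairall a b -> aeq (Psi a b) (Phi a b)) &
      (forall a b, inL2pair rho a b -> forall e : R, 0 < e ->
         exists2 d : R, 0 < d & forall a' b', inL2pair rho a' b' ->
           (wnorm2 rho (fsub a' a) (fsub b' b) < d%:E)%E ->
           (wnorm rho (fsub (Psi a' b') (Psi a b)) < e%:E)%E)].

(* Main.v *)
Require Import Defs.
From HB Require Import structures.
From mathcomp Require Import all_boot all_order all_algebra.
From mathcomp Require Import all_classical all_reals all_analysis.
From mathcomp Require Import measurable_realfun ring lra.
Import Order.TTheory GRing.Theory Num.Theory.
Import numFieldNormedType.Exports.
Local Open Scope classical_set_scope.
Local Open Scope ring_scope.

(** Write [g] for the derivative of [u].  On the space of functions that are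
    square integrable for the weight [expR (- 2 rho t)], integration from [-oo]
    has norm at most [1 / rho]; composition with the inverse of [alpha] is
    bounded independently of [rho], and composition with the inverse of [beta]
    gains a factor [expR (- rho eps0)] because [beta] delays by at least [eps0].
    Hence [g |-> Phirho (u \o alphainv) (g \o betainv)], with [u] the primitive
    of [g], is a contraction for large [rho], and its fixed point is the solution.

    Causality of [Phi] comes from the uniformity of its Lipschitz constant: if
    two arguments agree before time [a], multiplying the estimate at [rho] by
    [expR (rho a)] and letting [rho] tend to infinity shows that the values agree
    before [a].  Causality of the extension follows by truncation, that of the
    delays from [s <= alpha s, beta s], and that of the weak derivative and of
    its inverse from testing with functions supported in [(-oo, a)]; to the left
    a function of weighted [L^2] is small enough to fix the integration constant.

    Vector-valued integrals are obtained from scalar ones by Riesz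
    representation. *)

(** * Strongly measurable functions *)

Section SMeasurable.
Context {R : realType} {H : normedModType R}.
Implicit Types (f g : R -> H).

(** The unknown of the contraction is [g] rather than [u] because the right-hand side contains the
    derivative itself: integration gains nothing in that argument, and only the strict delay of
    [beta] makes it small. Estimates are made on squared norms ([energy]), where the two arguments
    of [Phi] simply add; the squared factor is [C^2 (La / rho^2 + Lb expR (- 2 rho eps))], and
    [threshold] brings it below [1 / 16]. The resulting rate [1 / 4] leaves room for the weights
    [4 ^+ n] in the series that proves completeness.

    An obstacle is that [Phi] is controlled at all large weights but only on functions lying in
    every weighted space, while its extension is known only to be continuous at one weight. Cutting
    to [[- n, n]] puts a function in every space and converges at the given weight, so the Lipschitz
    bound has to be transported this way before the contraction can be stated.

    Another is that [H] may be nonseparable. Strong measurability then enters through a sequence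
    approximating the range, so that countably many test vectors suffice almost everywhere. *)

Lemma simple_fun_comp_measurable g (F : H -> R) :
  simple_fun g -> measurable_fun setT (F \o g).
Proof.
move=> [fg mg] _ B mB; rewrite setTI.
have -> : (F \o g) @^-1` B = \bigcup_(y in range g `&` (F @^-1` B)) (g @^-1` [set y]).
  apply/seteqP; split => [t /= Bt|t [y [_ /= By] /= ->]//].
  by exists (g t) => //; split => //; exists t.
by apply: fin_bigcup_measurable => //; exact: finite_setIl.
Qed.

Lemma simple_fun_map2 {H' : normedModType R} (F : H -> H' -> H) g (g' : R -> H') :
  simple_fun g -> simple_fun g' -> simple_fun (fun t => F (g t) (g' t)).
Proof.
move=> [fg mg] [fg' mg']; split.
  apply: (@sub_finite_set _ _ ((fun p => F p.1 p.2) @` (range g `*` range g'))).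
    by move=> _ [t _ <-]; exists (g t, g' t) => //; split; exists t.
  by apply: finite_image; exact: finite_setX.
move=> y.
have -> : (fun t => F (g t) (g' t)) @^-1` [set y] =
  \bigcup_(p in (range g `*` range g') `&` [set p | F p.1 p.2 = y])
    (g @^-1` [set p.1] `&` g' @^-1` [set p.2]).
  apply/seteqP; split => [t /= <-|t [[a b] [_ /= <-] /= [-> ->]]//].
  exists (g t, g' t) => //=; split => //; split; by exists t.
apply: fin_bigcup_measurable; first by apply: finite_setIl; exact: finite_setX.
by move=> p _; apply: measurableI.
Qed.

Lemma simple_fun_cst (h : H) : simple_fun (fun _ : R => h).
Proof.
split; first by apply: (@sub_finite_set _ _ [set h]) => // _ [t _ <-].
move=> y; have [->|/eqP hy] := eqVneq h y.
  by rewrite (_ : _ @^-1` _ = setT)//; apply/seteqP; split.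
by rewrite (_ : _ @^-1` _ = set0)//; apply/seteqP; split => // t /= /hy.
Qed.

Lemma simple_fun_if (A : set R) g g' : measurable A ->
  simple_fun g -> simple_fun g' ->
  simple_fun (fun t => if t \in A then g t else g' t).
Proof.
move=> mA [fg mg] [fg' mg']; split.
  apply: (@sub_finite_set _ _ (range g `|` range g')).
    by move=> _ [t _ <-]; case: ifPn => _; [left|right]; exists t.
  by rewrite finite_setU.
move=> y.
have -> : (fun t => if t \in A then g t else g' t) @^-1` [set y] =
  (A `&` g @^-1` [set y]) `|` (~` A `&` g' @^-1` [set y]).
  apply/seteqP; split => [t /=|t /=]; case: ifPn.
  - by rewrite inE => At; left.
  - by rewrite notin_setE => At; right.
  - by rewrite inE => At [[]|[]].
  - by rewrite notin_setE => At [[]|[]].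
by apply: measurableU; apply: measurableI => //; exact: measurableC.
Qed.

Lemma simple_fun_comp g (p : R -> R) : measurable_fun setT p ->
  simple_fun g -> simple_fun (g \o p).
Proof.
move=> mp [fg mg]; split; first by apply: sub_finite_set fg => _ [t _ <-]; exists (p t).
by move=> y; rewrite -(setTI (_ @^-1` _)) comp_preimage; apply: mp.
Qed.

Lemma smeasurable_map2 {H' : normedModType R} (F : H -> H' -> H) f (f' : R -> H') :
  continuous (fun p : H * H' => F p.1 p.2) ->
  smeasurable f -> smeasurable f' -> smeasurable (fun t => F (f t) (f' t)).
Proof.
move=> cF [g [sg gf]] [g' [sg' gf']].
exists (fun n t => F (g n t) (g' n t)); split => [n|t].
  exact: simple_fun_map2.
have : (g n t, g' n t) @[n --> \oo] --> (f t, f' t) by exact: cvg_pair.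
by move=> /(cvg_comp _ _)/(_ (cF (f t, f' t))).
Qed.

Lemma smeasurable_cst (h : H) : smeasurable (fun _ : R => h).
Proof. by exists (fun=> fun=> h); split => [n|t]; [exact: simple_fun_cst|exact: cvg_cst]. Qed.

Lemma smeasurable_fsub f g : smeasurable f -> smeasurable g -> smeasurable (fsub f g).
Proof.
apply: (@smeasurable_map2 H (fun x y => x - y)) => p.
by apply: cvgB; [exact: cvg_fst|exact: cvg_snd].
Qed.

Lemma smeasurable_if (A : set R) f g : measurable A ->
  smeasurable f -> smeasurable g ->
  smeasurable (fun t => if t \in A then f t else g t).
Proof.
move=> mA [s [ss sf]] [s' [ss' sg]].
exists (fun n t => if t \in A then s n t else s' n t); split => [n|t].
  exact: simple_fun_if.
by case: ifPn => _.
Qed.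

Lemma smeasurable_comp f (p : R -> R) : measurable_fun setT p ->
  smeasurable f -> smeasurable (f \o p).
Proof.
move=> mp [s [ss sf]]; exists (fun n => s n \o p); split => [n|t].
  exact: simple_fun_comp.
exact: sf.
Qed.

(** Pettis-style description of strong measurability: the terms of [d] come arbitrarily close to
    each value of [f], without having to be dense in [H], and only distances to fixed vectors are
    measured. In this form the property passes directly to pointwise limits. *)
Definition separably_measurable f := exists d : nat -> H,
  (forall t e, 0 < e -> exists k, `|f t - d k| < e) /\
  (forall h, measurable_fun setT (fun t => `|f t - h|)).

Lemma smeasurable_separable f : smeasurable f -> separably_measurable f.
Proof.
move=> [g [sg gf]].
have /choice[s hs] : forall n, exists s : seq H, range (g n) = [set` s].
  by move=> n; apply/finite_seqP; have [] := sg n.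
(* [k] codes a pair: the [i]-th value of [g n]. The zeros are defaults for indices that code
   nothing. *)
exists (fun k => if unpickle k is Some (n, i) then nth 0 (s n) i else 0); split.
  move=> t e e0; have /cvgrPdist_lt/(_ _ e0)[N _ /(_ N (leqnn _))] := gf t.
  move=> /= fe; have : range (g N) (g N t) by exists t.
  rewrite hs /= => gs; exists (pickle (N, index (g N t) (s N))).
  by rewrite pickleK nth_index.
move=> h; apply: (@measurable_fun_cvg _ _ _ _ (fun n t => `|g n t - h|)).
  by move=> n; exact: (@simple_fun_comp_measurable (g n) (fun y => `|y - h|)).
move=> t _; apply: cvg_norm; apply: cvgB; [exact: gf|exact: cvg_cst].
Qed.

(* [g n t] is a nearest point to [f t] among [d 0, ..., d n]. *)
Lemma separable_smeasurable f : separably_measurable f -> smeasurable f.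
Proof.
move=> [d [df mf]].
pose g := fix g n t := if n is m.+1
  then if `|f t - d n| < `|f t - g m t| then d n else g m t else d 0%N.
have mg n : measurable_fun setT (fun t => `|f t - g n t|).
  elim: n => [|n ih]; first exact: mf.
  rewrite (_ : (fun t => _) = (fun t => Num.min `|f t - d n.+1| `|f t - g n t|)).
    by apply: measurable_minr.
  by apply/funext => t /=; rewrite minElt; case: ifPn.
have gle n k t : (k <= n)%N -> `|f t - g n t| <= `|f t - d k|.
  elim: n => [|n ih]; first by rewrite leqn0 => /eqP ->.
  rewrite leq_eqVlt => /predU1P[->|/ih gk] /=.
    by case: ltP.
  by case: ltP => // /ltW /le_trans; exact.
exists g; split.
  elim=> [|n ih]; first exact: simple_fun_cst.
  pose A := [set t | `|f t - d n.+1| < `|f t - g n t|].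
  have -> : g n.+1 = fun t => if t \in A then d n.+1 else g n t.
    by apply/funext => t /=; rewrite /A; case: ifPn => h;
      [rewrite mem_set|rewrite memNset//; exact/negP].
  apply: simple_fun_if => //; last exact: simple_fun_cst.
  by rewrite -[A]setTI; apply: measurable_fun_ltr.
move=> t; apply/cvgrPdist_lt => e e0.
have [k fk] := df t _ e0; exists k => // n /= kn.
by apply: le_lt_trans fk; exact: gle.
Qed.

(** The sequences attached to the [F n] are merged into one, which spares a diagonal choice of
    simple functions. *)
Lemma smeasurable_cvg (F : nat -> R -> H) f : (forall n, smeasurable (F n)) ->
  (forall t, F n t @[n --> \oo] --> f t) -> smeasurable f.
Proof.
move=> mF Ff; apply: separable_smeasurable.
have /choice[d hd] : forall n, separably_measurable (F n).
  by move=> n; exact: smeasurable_separable.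
exists (fun k => if unpickle k is Some (n, i) then d n i else 0); split.
  move=> t e e0; have e20 : 0 < e / 2 by rewrite divr_gt0.
  have /cvgrPdist_lt/(_ _ e20)[N _ /(_ N (leqnn _)) /= fF] := Ff t.
  have [k Fk] := (hd N).1 t _ e20; exists (pickle (N, k)); rewrite pickleK.
  rewrite -(subrK (F N t) (f t)) -addrA; apply: le_lt_trans (ler_normD _ _) _.
  by rewrite [ltRHS](splitr e) ltrD.
move=> h; apply: (@measurable_fun_cvg _ _ _ _ (fun n t => `|F n t - h|)).
  by move=> n; exact: (hd n).2.
move=> t _; apply: cvg_norm; apply: cvgB; [exact: Ff|exact: cvg_cst].
Qed.

(** The values at rational times approximate the whole range. *)
Lemma continuous_smeasurable f : continuous f -> smeasurable f.
Proof.
move=> cf; apply: separable_smeasurable.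
exists (fun k => if unpickle k is Some q then f (ratr q : R) else 0); split.
  move=> t e e0; have /cvgrPdist_lt/(_ _ e0) := cf t.
  move=> [r /= r0 fr].
  have [q] := @rat_in_itvoo R t (t + r) ltac:(by rewrite ltrDl).
  rewrite in_itv /= => /andP[tq qr]; exists (pickle q); rewrite pickleK.
  by apply: fr => /=; rewrite distrC gtr0_norm ?subr_gt0// ltrBlDl.
move=> h; apply: continuous_measurable_fun => t.
by apply: cvg_norm; apply: cvgB; [exact: cf|exact: cvg_cst].
Qed.
End SMeasurable.

(** * Weighted square-integrable functions *)

Section Energy.
Context {R : realType} {H : normedModType R}.
Implicit Types (rho : R) (f g h : R -> H).

Lemma ae_imply (P Q : R -> Prop) : (forall t, P t -> Q t) ->
  {ae leb, forall t, P t} -> {ae leb, forall t, Q t}.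
Proof. by move=> PQ; apply: (@filterS _ _ (ae_filter_ringOfSetsType leb)). Qed.

Lemma ae_imply2 (P Q S : R -> Prop) : (forall t, P t -> Q t -> S t) ->
  {ae leb, forall t, P t} -> {ae leb, forall t, Q t} -> {ae leb, forall t, S t}.
Proof. by move=> PQ; apply: (@filterS2 _ _ (ae_filter_ringOfSetsType leb)). Qed.

Lemma measurable_weight rho : measurable_fun setT (fun t : R => expR (- (rho * t))).
Proof.
apply: measurableT_comp; first exact: measurable_expR.
by apply: measurableT_comp => //; exact: mulrl_measurable.
Qed.

Lemma smeasurable_norm f : smeasurable f -> measurable_fun setT (fun t => `|f t|).
Proof.
move=> /smeasurable_separable[d [_ /(_ 0)]].
by under [X in measurable_fun _ X -> _]eq_fun do rewrite subr0.
Qed.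

(** The square of [wnorm]: it is additive over the two arguments of [wnorm2], and comparisons of
    weights become comparisons of integrands. *)
Definition energy rho f : \bar R :=
  \int[leb]_t ((`|f t| * expR (- (rho * t))) ^+ 2)%:E.

Lemma measurable_energy rho f : smeasurable f ->
  measurable_fun setT (fun t => ((`|f t| * expR (- (rho * t))) ^+ 2)%:E).
Proof.
move=> mf; apply/measurable_EFinP; apply: measurable_funX.
apply: measurable_funM; [exact: smeasurable_norm|exact: measurable_weight].
Qed.

Lemma energy_ge0 rho f : (0 <= energy rho f)%E.
Proof. by apply: integral_ge0 => t _; rewrite lee_fin sqr_ge0. Qed.

Lemma rwnormE rho (f : R -> R) :
  rwnorm rho f = sqrte (\int[leb]_t ((f t * expR (- (rho * t))) ^+ 2)%:E).
Proof.
rewrite /rwnorm unlock /= -poweR12_sqrt; last first.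
  by apply: integral_ge0 => t _; rewrite lee_fin sqr_ge0.
congr (_ `^ _)%E; apply: eq_integral => t _.
by rewrite powR_mulrn// real_normK// num_real.
Qed.

Lemma wnormE rho f : wnorm rho f = sqrte (energy rho f).
Proof. exact: rwnormE. Qed.

Lemma wnorm2E rho f g : smeasurable f -> smeasurable g ->
  wnorm2 rho f g = sqrte (energy rho f + energy rho g).
Proof.
move=> mf mg; rewrite /wnorm2 rwnormE -ge0_integralD//.
- congr sqrte; apply: eq_integral => t _; rewrite -EFinD; congr EFin.
  by rewrite !exprMn sqr_sqrtr ?mulrDl// addr_ge0 ?sqr_ge0.
- exact: measurable_energy.
- exact: measurable_energy.
Qed.

Lemma sqrte_lty (x : \bar R) : (0 <= x)%E -> (sqrte x < +oo)%E = (x < +oo)%E.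
Proof.
move=> x0; rewrite -!ge0_fin_numE ?sqrte_ge0//.
exact: sqrte_fin_num.
Qed.

Lemma inL2E rho f : inL2 rho f <-> smeasurable f /\ (energy rho f < +oo)%E.
Proof. by rewrite /inL2 wnormE sqrte_lty ?energy_ge0. Qed.

Lemma inL2pairE rho f g : inL2pair rho f g <-> inL2 rho f /\ inL2 rho g.
Proof.
split => [[mf mg]|[/inL2E[mf ef] /inL2E[mg eg]]].
  rewrite wnorm2E// sqrte_lty; last by rewrite adde_ge0 ?energy_ge0.
  move=> e.
  split; apply/inL2E; split => //; apply: le_lt_trans e.
    by rewrite leeDl// energy_ge0.
  by rewrite leeDr// energy_ge0.
by split=> //; rewrite wnorm2E// sqrte_lty; [exact: lte_add_pinfty|rewrite adde_ge0 ?energy_ge0].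
Qed.

Lemma energy_le rho f g : smeasurable f -> smeasurable g ->
  (forall t, `|f t| <= `|g t|) -> (energy rho f <= energy rho g)%E.
Proof.
move=> mf mg fg; apply: ge0_le_integral => //.
- exact: measurable_energy.
- exact: measurable_energy.
- move=> t _; rewrite lee_fin ler_sqr ?nnegrE ?mulr_ge0 ?expR_ge0//.
  by rewrite ler_wpM2r ?expR_ge0.
Qed.

Lemma energy_fsubC rho f g : energy rho (fsub f g) = energy rho (fsub g f).
Proof. by apply: eq_integral => t _; rewrite /fsub distrC. Qed.

Lemma wnorm_fsubC rho f g : wnorm rho (fsub f g) = wnorm rho (fsub g f).
Proof. by rewrite !wnormE energy_fsubC. Qed.

Lemma wnorm_ge0 rho f : (0 <= wnorm rho f)%E.
Proof. by rewrite wnormE sqrte_ge0. Qed.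

(** The pointwise triangle inequality in [H] reduces this to Minkowski's inequality for the scalar
    functions [F]. *)
Lemma wnorm_triangle rho f g h : smeasurable f -> smeasurable g -> smeasurable h ->
  (wnorm rho (fsub f h) <= wnorm rho (fsub f g) + wnorm rho (fsub g h))%E.
Proof.
move=> mf mg mh.
pose F (p : R -> H) t := `|p t| * expR (- (rho * t)).
have mF p : smeasurable p -> measurable_fun setT (F p).
  by move=> mp; apply: measurable_funM; [exact: smeasurable_norm|exact: measurable_weight].
have mfg := smeasurable_fsub f g mf mg; have mgh := smeasurable_fsub g h mg mh.
have mfh := smeasurable_fsub f h mf mh.
apply: (@le_trans _ _ (Lnorm leb 2%:E (EFin \o (F (fsub f g) \+ F (fsub g h))))); last first.
  by apply: minkowski_EFin; [exact: mF|exact: mF|rewrite ler1n].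
rewrite unlock /=; rewrite wnormE -poweR12_sqrt ?energy_ge0//.
apply: gt0_ler_poweR; first by rewrite invr_ge0.
- by rewrite in_itv /= energy_ge0 leey.
- by rewrite in_itv /= leey andbT integral_ge0// => t _; rewrite lee_fin powR_ge0.
apply: ge0_le_integral => //.
- exact: measurable_energy.
- apply/measurable_EFinP; apply: (measurableT_comp (@measurable_powR R 2)).
  by apply: measurableT_comp => //; apply: measurable_funD; exact: mF.
- move=> t _; rewrite lee_fin powR_mulrn// real_normK ?num_real//.
  rewrite ler_sqr ?nnegrE ?addr_ge0 ?mulr_ge0 ?expR_ge0// /F -mulrDl.
  by rewrite ler_wpM2r ?expR_ge0// /fsub -(subrKA (g t)) ler_normD.
Qed.

Lemma energy0_ae rho f : smeasurable f -> energy rho f = 0%E ->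
  {ae leb, forall t, f t = 0}.
Proof.
move=> mf ef0.
have /(ae_eq_integral_abs leb measurableT)[+ _] := measurable_energy rho f mf.
rewrite (_ : \int[_]_(_ in _) _ = 0)%E; last first.
  rewrite -[RHS]ef0; apply: eq_integral => t _; rewrite gee0_abs//.
move=> /(_ erefl); apply: ae_imply => t /(_ I) [] /eqP.
rewrite sqrf_eq0 mulf_eq0 normr_eq0 (gt_eqF (expR_gt0 _)) orbF.
by move=> /eqP.
Qed.

Lemma ae_energy_eq rho f g : smeasurable f -> smeasurable g -> aeq f g ->
  energy rho f = energy rho g.
Proof.
move=> mf mg fg; apply: ge0_ae_eq_integral => //.
- exact: measurable_energy.
- exact: measurable_energy.
by apply: ae_imply fg => t /= ->.
Qed.

Lemma wnorm0_aeq rho f g : smeasurable f -> smeasurable g ->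
  wnorm rho (fsub f g) = 0%E -> aeq f g.
Proof.
move=> mf mg; rewrite wnormE => w0.
have e0 : energy rho (fsub f g) = 0%E.
  by rewrite -(sqr_sqrte (energy_ge0 _ _)) w0 expe2 mule0.
have := energy0_ae rho _ (smeasurable_fsub _ _ mf mg) e0.
by apply: ae_imply => t /eqP; rewrite subr_eq0 => /eqP.
Qed.

Lemma aeq_wnorm rho f g f' g' :
  smeasurable f -> smeasurable g -> smeasurable f' -> smeasurable g' ->
  aeq f f' -> aeq g g' -> wnorm rho (fsub f g) = wnorm rho (fsub f' g').
Proof.
move=> mf mg mf' mg' ff gg; rewrite !wnormE; congr sqrte.
apply: ae_energy_eq; [exact: smeasurable_fsub|exact: smeasurable_fsub|].
by apply: ae_imply2 ff gg => t; rewrite /fsub => -> ->.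
Qed.

Lemma inL2_fsub rho f g : inL2 rho f -> inL2 rho g -> inL2 rho (fsub f g).
Proof.
move=> [mf wf] [mg wg]; split; first exact: smeasurable_fsub.
have m0 := smeasurable_cst (0 : H).
apply: le_lt_trans (wnorm_triangle rho f _ g mf m0 mg) _.
have f0 : fsub f (fun=> 0) = f by apply/funext => t; rewrite /fsub subr0.
have g0 : fsub g (fun=> 0) = g by apply/funext => t; rewrite /fsub subr0.
by rewrite f0 wnorm_fsubC g0 lte_add_pinfty.
Qed.

Lemma inL2_0 rho : inL2 rho (fun=> (0 : H)).
Proof.
apply/inL2E; split; first exact: smeasurable_cst.
rewrite /energy; under eq_integral do rewrite normr0 mul0r expr0n.
by rewrite integral0.
Qed.

Lemma inL2_aeq rho f g : smeasurable g -> aeq f g -> inL2 rho f -> inL2 rho g.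
Proof.
by move=> mg fg /inL2E[mf ef]; apply/inL2E; split; rewrite // -(ae_energy_eq rho _ _ mf mg fg).
Qed.

(** * Truncation to bounded intervals *)

Definition truncate (n : nat) f t : H := if t \in `[- n%:R, n%:R]%classic then f t else 0.

Lemma smeasurable_truncate n f : smeasurable f -> smeasurable (truncate n f).
Proof. by move=> mf; apply: smeasurable_if => //; exact: smeasurable_cst. Qed.

Lemma truncate_fsub n f g : fsub (truncate n f) (truncate n g) = truncate n (fsub f g).
Proof. by apply/funext => t; rewrite /fsub /truncate; case: ifPn; rewrite ?subr0. Qed.

Lemma energy_truncate_le rho n f : smeasurable f ->
  (energy rho (truncate n f) <= energy rho f)%E.
Proof.
move=> mf; apply: energy_le => //; first exact: smeasurable_truncate.
by move=> t; rewrite /truncate; case: ifPn => // _; rewrite normr0.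
Qed.

Lemma inL2_truncate rho n f : inL2 rho f -> inL2 rho (truncate n f).
Proof.
move=> /inL2E[mf ef]; apply/inL2E; split; first exact: smeasurable_truncate.
by apply: le_lt_trans ef; exact: energy_truncate_le.
Qed.

(** On [[- n, n]] two exponential weights differ by a factor of at most [expR (|rho - eta| n)]. *)
Lemma inL2all_truncate rho n f : inL2 rho f -> inL2all (truncate n f).
Proof.
move=> /inL2E[mf ef] eta eta0; apply/inL2E; split; first exact: smeasurable_truncate.
pose c := expR (`|rho - eta| * n%:R) ^+ 2.
have c0 : 0 <= c by rewrite sqr_ge0.
apply: (@le_lt_trans _ _ (c%:E * energy rho f)%E); last first.
  by rewrite lte_mul_pinfty.
rewrite /energy -ge0_integralZl_EFin//; last first.
  exact: measurable_energy.
apply: ge0_le_integral => //.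
- by apply: measurable_energy; exact: smeasurable_truncate.
- by apply: measurable_funeM; exact: measurable_energy.
move=> t _; rewrite -EFinM lee_fin -exprMn ler_sqr ?nnegrE ?mulr_ge0 ?expR_ge0//.
rewrite /truncate; case: ifPn => [|_]; last by rewrite normr0 mul0r !mulr_ge0 ?expR_ge0.
rewrite inE /= in_itv /= => tn.
rewrite mulrCA ler_wpM2l// -expRD ler_expR.
have : (rho - eta) * t <= `|rho - eta| * n%:R.
  apply: le_trans (ler_norm _) _; rewrite normrM ler_wpM2l// ler_norml.
  exact: tn.
lra.
Qed.

(** Dominated convergence, with the integrand of [f] as the bound; at each [t] the difference is
    eventually zero. The estimate is on the squared norm. *)
Lemma wnorm_truncate_cvg rho f : inL2 rho f -> forall e : R, 0 < e ->
  exists N, forall n, (N <= n)%N -> (energy rho (fsub (truncate n f) f) < e%:E)%E.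
Proof.
move=> /inL2E[mf ef] e e0.
have mt n := smeasurable_fsub _ _ (smeasurable_truncate n f mf) mf.
have ig : leb.-integrable setT (fun t => ((`|f t| * expR (- (rho * t))) ^+ 2)%:E).
  apply/integrableP; split; first exact: measurable_energy.
  under eq_integral do rewrite gee0_abs ?lee_fin ?sqr_ge0//.
  exact: ef.
have [] := @dominated_convergence _ _ _ leb setT measurableT
  (fun n t => ((`|fsub (truncate n f) f t| * expR (- (rho * t))) ^+ 2)%:E) (cst 0%E) _
  _ _ _ ig _.
- by move=> n; exact: measurable_energy.
- exact: measurable_cst.
- apply/aeW => t _; apply: (@cvg_near_cst _ _ (0%E : \bar R)).
  have [N tN] : exists N, `|t| <= N%:R.
    by exists (Num.bound `|t|); apply/ltW/archi_boundP.
  exists N => // n /= Nn; rewrite /fsub /truncate mem_set ?subrr ?normr0 ?mul0r ?expr0n//.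
  by rewrite /= in_itv /= -ler_norml (le_trans tN)// ler_nat.
- apply/aeW => t n _; rewrite gee0_abs ?lee_fin ?sqr_ge0//.
  rewrite ler_sqr ?nnegrE ?mulr_ge0 ?expR_ge0// ler_wpM2r ?expR_ge0//.
  by rewrite /fsub /truncate; case: ifPn => _; rewrite ?subrr ?normr0// sub0r normrN.
move=> _ _; rewrite integral0 => /fine_cvgP[fin /cvgrPdist_lt/(_ _ e0) cv].
have [N _ HN] := filterI fin cv; exists N => n Nn.
have [/= fn] := HN n Nn; rewrite sub0r normrN /energy -{2}(fineK fn) lte_fin.
by apply: le_lt_trans; exact: ler_norm.
Qed.

End Energy.

(** * Test functions *)

Section Smooth.
Context {R : realType}.
Implicit Types (f g phi psi : R -> R).

(** Recursion on the order of differentiability, for all functions at once, suits the closure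
    proofs; [smoothnP] relates it to the iterated derivatives in [test_fun]. *)
Fixpoint smoothn n f : Prop :=
  if n is m.+1 then (forall x, derivable f x 1) /\ smoothn m (derive1 f) else True.

Lemma smoothnP f : (forall n, smoothn n f) <->
  (forall n x, derivable (iter n (fun g : R -> R => derive1 g) f) x 1).
Proof.
split => [sf n|df n].
  elim: n f sf => [|n ih] f sf x; first by have [] := sf 1%N.
  by rewrite iterSr; apply: ih => m; have [] := sf m.+1.
elim: n f df => [//|n ih] f df /=; split; first exact: (df 0%N).
by apply: ih => m x; have := df m.+1 x; rewrite iterSr.
Qed.

Lemma smoothnS n f : smoothn n.+1 f -> smoothn n f.
Proof.
elim: n f => [//|n ih] f [df sf]; split => //; exact: ih.
Qed.

Lemma is_derive_smooth n f (x : R) : smoothn n.+1 f -> is_derive x 1 f (derive1 f x).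
Proof. by move=> [df _]; rewrite derive1E; split. Qed.

Lemma derive1_eq f (df : R -> R) : (forall x : R, is_derive x 1 f (df x)) ->
  (forall x, derivable f x 1) /\ derive1 f = df.
Proof.
move=> fdf; split => [x|]; first by have [] := fdf x.
by apply/funext => x; rewrite derive1E; have [] := fdf x.
Qed.

Lemma smoothn_cst n (c : R) : smoothn n (cst c).
Proof.
elim: n c => [//|n ih] c /=; have [d ->] := derive1_eq (cst c) (cst 0) (fun x => is_derive_cst c x 1).
by split.
Qed.

Lemma smoothnD n f g : smoothn n f -> smoothn n g -> smoothn n (f \+ g).
Proof.
elim: n f g => [//|n ih] f g sf sg /=.
have [d ->] := derive1_eq (f \+ g) (derive1 f \+ derive1 g)
  (fun x => is_deriveD (is_derive_smooth n f x sf) (is_derive_smooth n g x sg)).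
by split => //; apply: ih; [case: sf|case: sg].
Qed.

Lemma smoothnM n f g : smoothn n f -> smoothn n g -> smoothn n (f \* g).
Proof.
elim: n f g => [//|n ih] f g sf sg /=.
have [d ->] := derive1_eq (f \* g) ((f \* derive1 g) \+ (g \* derive1 f))
  (fun x => is_deriveM (is_derive_smooth n f x sf) (is_derive_smooth n g x sg)).
split => //; apply: smoothnD; apply: ih; try exact: smoothnS.
  by case: sg.
by case: sf.
Qed.

Lemma is_derive_affine (c b x : R) : is_derive x 1 (fun x => c * x + b) c.
Proof.
have -> : (fun x => c * x + b) = (c \*: (@id R)) \+ cst b by [].
by apply: is_derive_eq; rewrite addr0 /= scaler1.
Qed.

Lemma is_derive_comp_affine f (df : R) (c b x : R) : is_derive (c * x + b) 1 f df ->
  is_derive x 1 (fun x => f (c * x + b)) (c * df).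
Proof.
move=> fd; have := @is_derive1_comp R f (fun x => c * x + b) x _ _ fd (is_derive_affine c b x).
by rewrite mulrC.
Qed.

Lemma smoothn_affine n f (c b : R) : smoothn n f -> smoothn n (fun x => f (c * x + b)).
Proof.
elim: n f => [//|n ih] f sf /=.
have [d ->] := derive1_eq (fun x => f (c * x + b)) (cst c \* (fun x => derive1 f (c * x + b)))
  (fun x => is_derive_comp_affine _ _ c b x (is_derive_smooth n f _ sf)).
split => //; apply: smoothnM; first exact: smoothn_cst.
by apply: ih; case: sf.
Qed.

(* This family is stable under differentiation, hence consists of smooth functions. *)
Definition flat (p : {poly R}) (x : R) : R :=
  if 0 < x then p.[x^-1] * expR (- x^-1) else 0.

(** This is [expR x >= x] at [x = y / (m + 1)], raised to the power [m + 1]. *)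
Lemma powX_expRN_le m (y : R) : 0 < y -> y ^+ m.+1 * expR (- y) <= m.+1%:R ^+ m.+1.
Proof.
move=> y0; rewrite expRN ler_pdivrMr ?expR_gt0//.
have -> : expR y = expR (y / m.+1%:R) ^+ m.+1.
  by rewrite -expRM_natl; congr expR; rewrite mulrC divfK.
rewrite -exprMn; apply: lerXn2r; rewrite ?nnegrE ?mulr_ge0 ?expR_ge0//; first exact: ltW.
rewrite -ler_pdivrMl// mulrC; apply: le_trans (expR_ge1Dx _).
by rewrite lerDr.
Qed.

(** A monomial of degree [i] in [1 / h] is bounded with the power [i + 1]; the spare power is the
    factor [h]. *)
Lemma flat_bound p : exists2 K : R, 0 <= K & forall h, `|flat p h| <= K * `|h|.
Proof.
exists (\sum_(i < size p) `|p`_i| * i.+1%:R ^+ i.+1).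
  by apply: sumr_ge0 => i _; rewrite mulr_ge0// exprn_ge0.
move=> h; rewrite /flat; case: ltP => [h0|_]; last first.
  by rewrite normr0 mulr_ge0// sumr_ge0// => i _; rewrite mulr_ge0// exprn_ge0.
have y0 : 0 < h^-1 by rewrite invr_gt0.
rewrite horner_coef mulr_suml (gtr0_norm h0) mulr_suml.
apply: le_trans (ler_norm_sum _ _ _) _; apply: ler_sum => i _.
rewrite !normrM -!mulrA ler_wpM2l// (gtr0_norm (expR_gt0 _)).
rewrite ger0_norm ?exprn_ge0 ?(ltW y0)// -ler_pdivrMr//.
by rewrite mulrAC -exprSr powX_expRN_le.
Qed.

Lemma flat_X p h : flat p h = h * flat ('X * p) h.
Proof.
rewrite /flat; case: ltP => [h0|_]; last by rewrite mulr0.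
by rewrite hornerM hornerX !mulrA divff ?gt_eqF// mul1r.
Qed.

(** For [x > 0] both the polynomial and the exponential are functions of [1 / x], whose derivative
    [- 1 / x^2] accounts for ['X^2] and the signs. Only the origin requires an estimate. *)
Lemma is_derive_flat p (x : R) : is_derive x 1 (flat p) (flat ('X^2 * (p - p^`())) x).
Proof.
have [x0|x0|<-] := ltgtP 0 x.
- pose F := (fun x : R => p.[x^-1] * expR (- x^-1)).
  have xn0 : x != 0 by rewrite gt_eqF.
  have dF : is_derive x 1 F (flat ('X^2 * (p - p^`())) x).
    have dinv : is_derive x 1 (fun x : R => x^-1) (- x ^- 2).
      have := @is_deriveV R (@id R) x 1 1 xn0 (is_derive_id _ _).
      by rewrite scaler1.
    have dp := @is_derive1_comp R (horner p) (fun x : R => x^-1) x _ _ (is_derive_poly p x^-1) dinv.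
    have de := @is_derive1_comp R expR (fun x : R => - x^-1) x _ _ (is_derive_expR _)
       (is_deriveN dinv).
    apply: (is_derive_eq (is_deriveM dp de)).
    rewrite /flat x0 !hornerE /= /GRing.scale /= exprVn.
    by rewrite opprK; ring.
  apply: near_eq_is_derive dF; near=> y; rewrite /flat ifT//.
  by near: y; exact: lt_nbhsr.
- apply: (@near_eq_is_derive _ _ _ (cst 0)); last first.
    by rewrite /flat ltNge (ltW x0); exact: is_derive_cst.
  near=> y; rewrite /flat ifF//; apply/negbTE; rewrite -leNgt ltW//.
  by near: y; exact: lt_nbhsl.
- rewrite {2}/flat ltxx.
  (* The difference quotient at 0 is [flat ('X * p)] itself, and it tends to 0 by the linear
     bound. *)
  have [K K0 fK] := flat_bound ('X * p).
  have L : h^-1 *: (flat p (h *: 1 + 0) - flat p 0) @[h --> 0^'] --> (0 : R).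
    apply/cvgr0Pnorm_lt => e e0.
    near=> h; have h0 : h != 0 by near: h; exact: nbhs_dnbhs_neq.
    rewrite {2}/flat ltxx subr0 addr0 /GRing.scale /= mulr1 flat_X mulKf//.
    apply: le_lt_trans (fK h) _.
    apply: (@le_lt_trans _ _ ((K + 1) * `|h|)); first by rewrite ler_wpM2r// lerDl.
    rewrite mulrC -ltr_pdivlMr; last by rewrite ltr_pwDr.
    by near: h; apply: dnbhs0_lt; rewrite divr_gt0// ltr_pwDr.
  by split; [apply/cvg_ex; exists 0|apply/cvg_lim].
Unshelve. all: by end_near. Qed.

Lemma smoothn_flat n p : smoothn n (flat p).
Proof.
elim: n p => [//|n ih] p /=.
by have [d ->] := derive1_eq _ _ (is_derive_flat p).
Qed.

Lemma flat1_ge0 x : 0 <= flat 1 x.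
Proof. by rewrite /flat; case: ifP => // _; rewrite hornerE mul1r expR_ge0. Qed.

Lemma flat1_le1 x : flat 1 x <= 1.
Proof.
rewrite /flat; case: ltP => // x0; rewrite hornerE mul1r -expR0 ler_expR.
by rewrite oppr_le0 invr_ge0 ltW.
Qed.

Lemma flat1_cvg (x : R) : 0 < x -> flat 1 (n%:R * x) @[n --> \oo] --> (1 : R).
Proof.
move=> x0.
have e : (fun n => expR (- (n%:R * x)^-1)) n @[n --> \oo] --> (1 : R).
  rewrite -[X in _ --> X]expR0; apply: continuous_cvg; first exact: continuous_expR.
  rewrite -[X in _ --> X]oppr0; apply: cvgN.
  rewrite (_ : (fun n : nat => _) = (fun n : nat => x^-1 * n%:R^-1)); last first.
    by apply/funext => n; rewrite invfM mulrC.
  rewrite -[X in _ --> X](mulr0 x^-1); apply: cvgMr.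
  have n0 : \forall n \near \oo, (0 : R) < n%:R by exists 1%N => // n /= n0; rewrite ltr0n.
  by have [_] := @gtr0_cvgV0 R nat \oo _ (fun n : nat => n%:R) n0; apply; exact: cvgr_idn.
apply: cvg_trans e; apply: near_eq_cvg; exists 1%N => // n /= n0.
by rewrite /flat mulr_gt0 ?ltr0n// hornerE mul1r.
Qed.

(** A smooth minorant of the indicator of []a, b[]: the factors are [flat 1] at [n (x - a)] and
    [n (b - x)], and [flat 1] tends to 1 at infinity. The arguments are spelled as affine maps to
    fit [smoothn_affine]. *)
Definition plateau (a b : R) (n : nat) (x : R) : R :=
  flat 1 (n%:R * x + - (n%:R * a)) * flat 1 (- n%:R * x + n%:R * b).

Lemma plateau_ge0 a b n x : 0 <= plateau a b n x.
Proof. by rewrite mulr_ge0 ?flat1_ge0. Qed.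

Lemma plateau_le1 a b n x : plateau a b n x <= 1.
Proof. by rewrite -[leRHS]mulr1 ler_pM ?flat1_ge0 ?flat1_le1. Qed.

Lemma plateau_out a b n x : x \notin `]a, b[ -> plateau a b n x = 0.
Proof.
rewrite in_itv /= negb_and -!leNgt /plateau /flat => /orP[xa|bx].
  by rewrite ifF ?mul0r//; apply/negbTE; rewrite -leNgt -mulrBr mulr_ge0_le0 ?subr_le0.
rewrite [X in _ * X]ifF ?mulr0//; apply/negbTE; rewrite -leNgt mulNr addrC -mulrBr.
by rewrite mulr_ge0_le0 ?subr_le0.
Qed.

Lemma plateau_cvg a b x : plateau a b n x @[n --> \oo] --> (\1_(`]a, b[%classic) x : R).
Proof.
rewrite indicE; case: (boolP (x \in `]a, b[)) => xab; last first.
  rewrite memNset//=; last exact/negP.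
  by apply: cvg_near_cst; apply: nearW => n; rewrite plateau_out.
rewrite mem_set//= -[X in _ --> X]mulr1.
move: xab; rewrite in_itv /= => /andP[ax xb].
apply: cvgM.
  rewrite (_ : (fun n : nat => _) = (fun n : nat => flat 1 (n%:R * (x - a)))).
    by apply: flat1_cvg; rewrite subr_gt0.
  by apply/funext => n; rewrite mulrBr.
rewrite (_ : (fun n : nat => _) = (fun n : nat => flat 1 (n%:R * (b - x)))).
  by apply: flat1_cvg; rewrite subr_gt0.
by apply/funext => n; rewrite mulrBr mulNr addrC.
Qed.

Lemma test_plateau a b n : test_fun (plateau a b n).
Proof.
split.
  apply/smoothnP => m.
  by apply: smoothnM; apply: smoothn_affine; exact: smoothn_flat.
exists (Num.max `|a| `|b|) => x; rewrite gt_max => /andP[ax bx].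
apply: plateau_out; rewrite in_itv /=; apply/negP => /andP[xa xb].
have [x0|x0] := leP 0 x.
  by move: bx; rewrite (ger0_norm x0); have := ler_norm b; lra.
by move: ax; rewrite (ltr0_norm x0) -normrN; have := ler_norm (- a); lra.
Qed.

Lemma test_derive1 phi : test_fun phi -> test_fun (derive1 phi).
Proof.
move=> [sphi [M phi0]]; split.
  by move=> n x; have := sphi n.+1 x; rewrite iterSr.
exists M => x Mx; rewrite derive1E.
rewrite (@near_eq_derive _ _ _ phi (cst 0)) ?derive_cst//.
near=> y; apply: phi0.
by near: y; apply: (cvgr_gt _ (@norm_continuous _ _ x)).
Unshelve. all: by end_near. Qed.

Lemma test_is_derive phi (x : R) : test_fun phi -> is_derive x 1 phi (derive1 phi x).
Proof. by move=> [sphi _]; rewrite derive1E; split; [exact: (sphi 0%N)|]. Qed.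

Lemma test_continuous phi : test_fun phi -> continuous phi.
Proof.
move=> [sphi _] x; apply: differentiable_continuous.
by apply/derivable1_diffP; exact: (sphi 0%N).
Qed.

Lemma test_measurable phi : test_fun phi -> measurable_fun setT phi.
Proof. by move=> tphi; apply: continuous_measurable_fun; exact: test_continuous. Qed.

Lemma test_support phi : test_fun phi ->
  exists2 M : R, 0 < M & forall x, M < `|x| -> phi x = 0.
Proof.
move=> [_ [M phi0]]; exists (Num.max M 1); first by rewrite lt_max ltr01 orbT.
by move=> x; rewrite gt_max => /andP[/phi0].
Qed.

Lemma test_bounded phi : test_fun phi -> exists2 K : R, 0 < K & forall x, `|phi x| <= K.
Proof.
move=> tphi; have [M M0 phi0] := test_support phi tphi.
have NMM : - M <= M by lra.
have cphi : {within `[- M, M], continuous (fun x => `|phi x|)}.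
  apply: continuous_subspaceT => x; apply: cvg_norm; exact: test_continuous.
have [c _ cmax] := EVT_max NMM cphi.
exists (`|phi c| + 1); first by rewrite ltr_wpDl.
move=> x; have [xM|xM] := ltP M `|x|; first by rewrite phi0// normr0 addr_ge0.
by apply: (@le_trans _ _ `|phi c|); [apply: cmax; rewrite in_itv /= -ler_norml|rewrite lerDl].
Qed.

Lemma test_mul_integrable phi (w : R -> R) : test_fun phi -> measurable_fun setT w ->
  (forall M, leb.-integrable `[- M, M]%classic (EFin \o w)) ->
  leb.-integrable setT (fun t => (w t * phi t)%:E).
Proof.
move=> tphi mw iw.
have [M M0 phi0] := test_support phi tphi.
have [K K0 phiK] := test_bounded phi tphi.
have mM : measurable (`[- M, M]%classic : set (measurableTypeR R)) by [].
have iwM := (integrable_mkcond _ mM).1 (integrableZl mM K (iw M)).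
apply: le_integrable iwM => //.
  by apply/measurable_EFinP; apply: measurable_funM => //; exact: test_measurable.
move=> t _; rewrite patchE; case: ifPn => [_|]; last first.
  rewrite notin_setE /= in_itv /= -ler_norml => /negP; rewrite -ltNge => /phi0 ->.
  by rewrite mulr0.
by rewrite !abse_EFin lee_fin !normrM mulrC ler_wpM2r// (gtr0_norm K0).
Qed.

Lemma test_integrable phi : test_fun phi -> leb.-integrable setT (EFin \o phi).
Proof.
move=> tphi; have := test_mul_integrable phi (cst 1) tphi.
rewrite (_ : (fun t => _) = EFin \o phi); last by apply/funext => t; rewrite /= mul1r.
apply => [|M]; first exact: measurable_cst.
apply: continuous_compact_integrable; first exact: segment_compact.
by apply: continuous_subspaceT => x; exact: cvg_cst.
Qed.

Lemma test_integral_derive1_tail phi s : test_fun phi ->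
  (\int[leb]_(t in `[s, +oo[) (derive1 phi t)%:E = (- phi s)%:E)%E.
Proof.
move=> tphi; have [M M0 phi0] := test_support phi tphi.
have tphi' := test_derive1 phi tphi.
have [M' M'0 phi0'] := test_support _ tphi'.
(* Past [b] both [phi] and its derivative vanish, so the tail is an integral over a compact
   interval. *)
pose b := Num.max (Num.max M M') s + 1.
have sb : s < b by rewrite ltr_pwDr// le_max lexx orbT.
have Mb : M < b by rewrite ltr_pwDr// !le_max lexx.
have Mb' : M' < b by rewrite ltr_pwDr// !le_max lexx orbT.
transitivity (\int[leb]_(t in `[s, b]) (derive1 phi t)%:E)%E.
  rewrite integral_mkcond [RHS]integral_mkcond; apply: eq_integral => t _.
  rewrite !patchE; case: (boolP (t \in `[s, b]%classic)) => [|].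
    by rewrite inE /= in_itv /= => /andP[st _]; rewrite mem_set//= in_itv /= st.
  rewrite notin_setE /= in_itv /= => /negP; rewrite negb_and -!ltNge => st.
  case: ifPn => //; rewrite inE /= in_itv /= andbT leNgt.
  case/orP: st => [->//|bt _]; rewrite phi0'//.
  by rewrite (lt_le_trans _ (ler_norm _))// (lt_trans Mb').
rewrite (@continuous_FTC2 _ (derive1 phi) phi s b sb).
- by rewrite (phi0 b) ?sub0e// (lt_le_trans Mb)// ler_norm.
- by apply: continuous_subspaceT => x; exact: test_continuous.
- split.
  + by move=> x _; have [] := test_is_derive phi x tphi.
  + by apply: cvg_at_right_filter; exact: test_continuous.
  + by apply: cvg_at_left_filter; exact: test_continuous.
- by [].
Qed.

End Smooth.

(** * Composition with the delays *)

Section ChangeOfVariable.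
Context {R : realType}.
Variables (alpha alphainv : R -> R).
Hypotheses (alphaK : cancel alpha alphainv) (alphainvK : cancel alphainv alpha).
Hypothesis alpha_ge : forall s, s <= alpha s.

Lemma lipschitz_bound (f : R -> R) : lipschitz f ->
  exists2 L : R, 0 < L & forall x y, `|f x - f y| <= L * `|x - y|.
Proof.
move=> [M [_ HM]]; exists (Num.max (M + 1) 1); first by rewrite lt_max ltr01 orbT.
move=> x y; have := HM (Num.max (M + 1) 1).
rewrite lt_max ltrDl ltr01 => /(_ isT) /(_ (x, y)) /=; apply.
by split.
Qed.

Variables (L : R) (L_gt0 : 0 < L).
Hypothesis alpha_lip : forall x y, `|alpha x - alpha y| <= L * `|x - y|.

Lemma lip_continuous : continuous alpha.
Proof.
move=> x; apply/cvgrPdist_lt => e e0; exists (e / L) => /=; first by rewrite divr_gt0.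
move=> y /= xy; apply: le_lt_trans (alpha_lip x y) _.
by rewrite mulrC -ltr_pdivlMr.
Qed.

(* Otherwise [alpha], which dominates the identity, would take the value
   [alpha s] a second time to the right of [t]. *)
Lemma lip_increasing s t : s < t -> alpha s < alpha t.
Proof.
move=> st; rewrite ltNge; apply/negP => ts.
pose M := Num.max (alpha s) t + 1.
have sM : alpha s < M by rewrite ltr_pwDr// le_max lexx.
have tM : t < M by rewrite ltr_pwDr// le_max lexx orbT.
have [//|||c] := @IVT R alpha t M (alpha s).
- exact: ltW.
- by apply: continuous_subspaceT; exact: lip_continuous.
- have aM : alpha s <= alpha M by rewrite (le_trans (ltW sM)).
  by rewrite ge_min ts /= le_max aM orbT.
rewrite in_itv /= => /andP[tc _] /(can_inj alphaK) cs.
by move: st; rewrite ltNge -cs tc.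
Qed.

Lemma lip_le_mono : {mono alpha : x y / x <= y}.
Proof. by apply: le_mono => x y; exact: lip_increasing. Qed.

Lemma inv_le_mono : {mono alphainv : x y / x <= y}.
Proof. by move=> x y; rewrite -lip_le_mono !alphainvK. Qed.

Lemma inv_measurable : measurable_fun setT alphainv.
Proof.
by apply: nondecreasing_measurable => // x y xy; rewrite inv_le_mono.
Qed.

Let p : measurableTypeR R -> measurableTypeR R := alphainv.
Let mp : measurable_fun setT p := inv_measurable.
Let mp_mixin := isMeasurableFun.Build _ _ _ _ _ mp.
Let mp_pack : {mfun _ >-> _} := HB.pack p mp_mixin.

Lemma preimage_inv_itv a b : alphainv @^-1` `]a, b]%classic = `]alpha a, alpha b]%classic.
Proof.
have lt_mono := leW_mono lip_le_mono.
have E t : (a < alphainv t <= b) = (alpha a < t <= alpha b).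
  by rewrite -[in RHS](alphainvK t) lt_mono lip_le_mono.
by apply/seteqP; split => t /=; rewrite !in_itv /= E.
Qed.

(** [alpha] stretches the length of an interval by at most [L]; this passes to measurable sets
    through the countable covers by half-open intervals that define Lebesgue measure. *)
Lemma leb_preimage_inv_le (A : set (measurableTypeR R)) : measurable A ->
  (leb (p @^-1` A) <= L%:E * leb A)%E.
Proof.
move=> mA; rewrite muleC -lee_pdivrMr//.
apply: le_ereal_inf_tmp => _ [F [mF AF] <-].
rewrite lee_pdivrMr// muleC -nneseriesZl; last first.
  by move=> i _; exact: wlength_ge0.
have mFp k : measurable (p @^-1` (F k : set (measurableTypeR R))).
  by rewrite -[X in measurable X]setTI; apply: mp => //; exact: sub_sigma_algebra.
apply: (@le_trans _ _ (\sum_(0 <= k <oo) leb (p @^-1` (F k : set (measurableTypeR R))))%E).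
  apply: (measure_sigma_subadditive (@lebesgue_measure R)) => //.
    by rewrite -[X in measurable X]setTI; exact: mp.
  by rewrite -preimage_bigcup; exact: preimage_subset.
apply: lee_nneseries => [k _ _|k _]; first exact: measure_ge0.
have [[a b] _ <-] := mF k.
rewrite /p /= preimage_inv_itv lebesgue_measure_itv.
rewrite [wlength _ _](wlength_itv idfun `]a, b]) /= !lte_fin.
rewrite (leW_mono lip_le_mono); case: ltP => [ab|ba]; last by rewrite mule0.
rewrite -!EFinB -EFinM lee_fin; apply: le_trans (ler_norm _) _.
by rewrite -[X in _ * X]gtr0_norm ?subr_gt0// alpha_lip.
Qed.

(** The left-hand side integrates [G] against the image of Lebesgue measure under [alphainv], which
    is dominated by [L] times Lebesgue measure. *)
Lemma ge0_integral_comp_inv_le (G : R -> R) : measurable_fun setT G ->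
  (forall s, 0 <= G s) ->
  (\int[leb]_t (G (alphainv t))%:E <= L%:E * \int[leb]_s (G s)%:E)%E.
Proof.
move=> mG G0.
have L0 : 0 <= L by exact: ltW.
have mGE : measurable_fun setT (fun s => (G s)%:E) by exact/measurable_EFinP.
have := @ge0_integral_pushforward _ _ _ _ _ _ mp leb setT (fun s => (G s)%:E)
  measurableT mGE (fun s _ => G0 s).
rewrite preimage_setT => <-.
rewrite -(@ge0_integral_mscale _ _ _ leb setT measurableT (NngNum L0) (fun s => (G s)%:E))//; last first.
  by move=> s _; rewrite lee_fin.
apply: (@ge0_le_measure_integral _ _ _ (pushforward leb mp_pack)) => // A mA.
exact: leb_preimage_inv_le.
Qed.

(** Null sets pull back to null sets, so composition with [alphainv] is well defined on
    almost-everywhere classes. *)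
Lemma ae_comp_inv (P : R -> Prop) : {ae leb, forall s, P s} ->
  {ae leb, forall t, P (alphainv t)}.
Proof.
move=> [N [mN N0 PN]]; exists (p @^-1` N); split.
- by rewrite -[X in measurable X]setTI; exact: mp.
- apply/eqP; rewrite eq_le measure_ge0 andbT.
  by have := leb_preimage_inv_le N mN; rewrite N0 mule0.
- by move=> t /= nP; apply: PN.
Qed.

(** At [t = alpha s] the weight [expR (- rho t)] is at most [expR (- rho d) * expR (- rho s)]. The
    case [d = 0] serves [alpha], the case of a strict delay serves [beta]. *)
Lemma energy_comp_inv_le {H : normedModType R} (rho d : R) (f : R -> H) : 0 < rho ->
  (forall s, s + d <= alpha s) -> smeasurable f ->
  (energy rho (f \o alphainv) <= (L * expR (- (2 * (rho * d))))%:E * energy rho f)%E.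
Proof.
move=> rho0 ad mf; rewrite EFinM -muleA.
(* The weight is moved to [alpha s] so that [G (alphainv t)] is exactly the integrand on the
   left. *)
pose G s := (`|f s| * expR (- (rho * alpha s))) ^+ 2.
have mG : measurable_fun setT G.
  apply: measurable_funX; apply: measurable_funM; first exact: smeasurable_norm.
  apply: measurableT_comp; first exact: measurable_expR.
  apply: measurableT_comp => //; apply: measurable_funM => //.
  by apply: continuous_measurable_fun; exact: lip_continuous.
apply: (@le_trans _ _ (L%:E * \int[leb]_s (G s)%:E)%E).
  have := ge0_integral_comp_inv_le G mG (fun s => sqr_ge0 _).
  by rewrite /G; under eq_integral do rewrite alphainvK.
apply: lee_wpmul2l; first by rewrite lee_fin ltW.
rewrite /energy -ge0_integralZl_EFin ?expR_ge0//; last first.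
  exact: measurable_energy.
apply: ge0_le_integral => //.
- by move=> s _; rewrite lee_fin sqr_ge0.
- exact/measurable_EFinP.
- by apply: measurable_funeM; exact: measurable_energy.
move=> s _; rewrite -EFinM lee_fin /G.
have -> : expR (- (2 * (rho * d))) = expR (- (rho * d)) ^+ 2.
  by rewrite expr2 -expRD; congr expR; ring.
rewrite -exprMn ler_sqr ?nnegrE ?mulr_ge0 ?expR_ge0//.
rewrite mulrCA ler_wpM2l// -expRD ler_expR -opprD lerN2 -mulrDr ler_pM2l// addrC.
exact: ad.
Qed.

Lemma inL2_comp_inv {H : normedModType R} (rho : R) (f : R -> H) : 0 < rho ->
  inL2 rho f -> inL2 rho (f \o alphainv).
Proof.
move=> rho0 /inL2E[mf ef]; apply/inL2E; split.
  by apply: smeasurable_comp => //; exact: inv_measurable.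
apply: le_lt_trans (energy_comp_inv_le rho 0 f rho0 _ mf) _ => [s|].
  by rewrite addr0.
by rewrite lte_mul_pinfty// lee_fin mulr_ge0 ?expR_ge0// ltW.
Qed.

(** Since [alphainv t <= t], the composition looks only at earlier times. *)
Lemma aeq_before_comp_inv {T : Type} a (f g : R -> T) : aeq_before a f g ->
  aeq_before a (f \o alphainv) (g \o alphainv).
Proof.
move=> /ae_comp_inv; apply: ae_imply => t fg ta; apply: fg.
by apply: le_lt_trans ta; rewrite -{2}(alphainvK t).
Qed.

End ChangeOfVariable.

(** * Riesz representation *)

Section Riesz.
Context {R : realType} {H : completeNormedModType R} (ip : H -> H -> R).
Hypothesis Hip : is_inner_product ip.

Lemma ipDl x y z : ip (x + y) z = ip x z + ip y z.
Proof. by case: Hip. Qed.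
Lemma ipZl a x y : ip (a *: x) y = a * ip x y.
Proof. by case: Hip. Qed.
Lemma ipC x y : ip x y = ip y x.
Proof. by case: Hip. Qed.
Lemma ipxx x : ip x x = `|x| ^+ 2.
Proof. by case: Hip. Qed.
Lemma ipDr x y z : ip x (y + z) = ip x y + ip x z.
Proof. by rewrite ipC ipDl !(ipC x). Qed.
Lemma ipZr a x y : ip x (a *: y) = a * ip x y.
Proof. by rewrite ipC ipZl (ipC x). Qed.
Lemma ip0l x : ip 0 x = 0.
Proof. by rewrite -(scale0r 0) ipZl mul0r. Qed.
Lemma ipBl x y z : ip (x - y) z = ip x z - ip y z.
Proof. by rewrite ipDl -scaleN1r ipZl mulN1r. Qed.
Lemma ipBr x y z : ip x (y - z) = ip x y - ip x z.
Proof. by rewrite ipC ipBl !(ipC x). Qed.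

Lemma sqr_normD x y : `|x + y| ^+ 2 = `|x| ^+ 2 + 2 * ip x y + `|y| ^+ 2.
Proof. by rewrite -!ipxx ipDl !ipDr (ipC y x); ring. Qed.

(** Expresses the inner product by distances to fixed vectors, the quantities that
    [separably_measurable] makes measurable; hence the unsimplified [x - 0]. *)
Lemma ip_polar x h : ip x h = (`|x - 0| ^+ 2 + `|h| ^+ 2 - `|x - h| ^+ 2) / 2.
Proof. by rewrite subr0 -!ipxx ipBl !ipBr (ipC h x); field. Qed.

Lemma cauchy_schwarz x y : `|ip x y| <= `|x| * `|y|.
Proof.
have [->|y0] := eqVneq y 0; first by rewrite ipC ip0l !normr0 mulr0.
have ny : 0 < `|y| by rewrite normr_gt0.
rewrite -ler_sqr ?nnegrE ?mulr_ge0// real_normK ?num_real// exprMn.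
(* The vector is [|y|^2] times the component of [x] orthogonal to [y], which avoids divisions. *)
have : 0 <= `|(`|y| ^+ 2) *: x - ip x y *: y| ^+ 2 by rewrite sqr_ge0.
rewrite -[X in 0 <= X -> _]ipxx !(ipBl, ipBr) !(ipZl, ipZr) !ipxx (ipC y x).
have ny2 : 0 < `|y| ^+ 2 by rewrite exprn_gt0.
set A := `|x| ^+ 2; set B := `|y| ^+ 2 in ny2 *; set c := ip x y.
have -> : B * (B * A) - B * (c * c) - (c * (B * c) - c * (c * B)) = B * (A * B - c ^+ 2) by ring.
by rewrite pmulr_rge0// subr_ge0.
Qed.

Variables (l : H -> R) (B : R).
Hypothesis l_lin : forall a x y, l (a *: x + y) = a * l x + l y.
Hypothesis l_bound : forall x, `|l x| <= B * `|x|.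

(* [u] is the minimiser of [|x|^2 / 2 - l x]; minimising sequences are Cauchy
   by the parallelogram identity. *)
Lemma riesz : exists u, forall h, ip u h = l h.
Proof.
pose J x := `|x| ^+ 2 / 2 - l x.
have Jlb x : - (B ^+ 2 / 2) <= J x.
  have := l_bound x; rewrite ler_norml /J => /andP[_ lB].
  have := sqr_ge0 (`|x| - B); nra.
have J0 : range J !=set0 by exists (J 0), 0.
have Jl : has_lbound (range J) by exists (- (B ^+ 2 / 2)) => _ [x _ <-].
pose m := inf (range J).
have mJ x : m <= J x by apply: ge_inf => //; exists x.
have /choice[x_ Jx] : forall n : nat, exists x, J x < m + n.+1%:R^-1.
  move=> n; have [|_ [x _ <-] Jx] := @inf_adherent R (range J) n.+1%:R^-1 _ (conj J0 Jl).
    by rewrite invr_gt0.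
  by exists x.
have lD x y : l (x + y) = l x + l y by rewrite -{1}(scale1r x) l_lin mul1r.
have l0 : l 0 = 0 by have := lD 0 0; rewrite addr0; lra.
have lZ a x : l (a *: x) = a * l x by rewrite -(addr0 (a *: x)) l_lin l0 addr0.
have par x y : `|x - y| ^+ 2 <= 4 * (J x + J y - 2 * m).
  have := mJ (2^-1 *: (x + y)); rewrite /J lZ lD.
  rewrite -!ipxx ipZl ipZr !(ipBl, ipBr, ipDl, ipDr) (ipC y x).
  lra.
have cx : cvg (x_ n @[n --> \oo]).
  apply/cauchy_cvgP/cauchy_exP => e e0.
  have e2 : 0 < e ^+ 2 / 8 by rewrite divr_gt0 ?exprn_gt0.
  have [N _ HN] := near_infty_natSinv_lt (PosNum e2).
  exists (x_ N); exists N => // n /= Nn.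
  rewrite -ball_normE /ball_ /= -ltr_sqr ?nnegrE ?(ltW e0)//.
  apply: le_lt_trans (par _ _) _.
  have := HN N (leqnn _); have := HN n Nn; rewrite /=.
  move: (Jx N) (Jx n); set a := n.+1%:R^-1; set b := N.+1%:R^-1.
  by move: (J _) (J _) a b => p q a b; set E := e ^+ 2; lra.
pose u := lim (x_ n @[n --> \oo]); exists u => h.
have ux : ip (x_ n) h @[n --> \oo] --> ip u h.
  apply/cvgrPdist_lt => e e0.
  have e1 : 0 < e / (`|h| + 1) by rewrite divr_gt0// ltr_wpDl.
  have /cvgrPdist_lt/(_ _ e1)[N _ HN] := cx; exists N => // n /= Nn.
  rewrite -ipBl; apply: le_lt_trans (cauchy_schwarz _ _) _.
  have := HN n Nn; rewrite /= ltr_pdivlMr ?ltr_wpDl//; apply: le_lt_trans.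
  by rewrite ler_wpM2l// lerDl.
(* First variation at [x_ n]: it fails to be nonnegative by at most [1 / (n + 1)], and only
   [ip (x_ n) h] has to be passed to the limit. *)
have var t : 0 <= t * (ip u h - l h) + t ^+ 2 * (`|h| ^+ 2 / 2).
  have : t * (ip (x_ n) h - l h) + t ^+ 2 * (`|h| ^+ 2 / 2) + n.+1%:R^-1
      @[n --> \oo] --> t * (ip u h - l h) + t ^+ 2 * (`|h| ^+ 2 / 2) + 0.
    apply: cvgD; last exact: cvg_harmonic.
    apply: cvgD; last exact: cvg_cst.
    by apply: cvgMr; apply: cvgB => //; exact: cvg_cst.
  rewrite addr0 => /cvgr_to_ge; apply; apply: nearW => n.
  have := mJ (x_ n + t *: h); have := Jx n; rewrite /J lD lZ sqr_normD ipZr normrZ exprMn.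
  have -> : `|t| ^+ 2 = t ^+ 2 by rewrite real_normK ?num_real.
  by move: (n.+1%:R^-1) => e; lra.
pose c := ip u h - l h; pose K := `|h| ^+ 2 / 2.
have K0 : 0 <= K by rewrite divr_ge0 ?sqr_ge0.
have K1 : 0 < 2 * K + 1 by lra.
(* Nearly the minimiser [- c / (2 K)] of the quadratic; the added 1 keeps the denominator positive
   when [h = 0]. *)
have := var (- c / (2 * K + 1)); rewrite -/c -/K.
have -> : - c / (2 * K + 1) * c + (- c / (2 * K + 1)) ^+ 2 * K =
  - (c ^+ 2 * (K + 1)) / (2 * K + 1) ^+ 2 by field; lra.
rewrite pmulr_lge0 ?invr_gt0 ?exprn_gt0// oppr_ge0 pmulr_lle0; last lra.
by rewrite le_eqVlt ltNge sqr_ge0 orbF sqrf_eq0 subr_eq0 => /eqP.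
Qed.
End Riesz.

(** * The fundamental lemma of the calculus of variations *)

Section Variations.
Context {R : realType}.
Implicit Types (w phi psi : R -> R).

(* Testing against [plateau c d n] and letting [n] tend to infinity gives
   [\int_(c, d) w = 0], so the primitive of [w] vanishes. *)
Lemma fundamental_lemma w (a : R) : measurable_fun setT w ->
  (forall b, leb.-integrable `]-oo, b]%classic (EFin \o w)) ->
  (forall psi, test_fun psi -> (forall x, a <= x -> psi x = 0) ->
     (\int[leb]_t (w t * psi t)%:E = 0)%E) ->
  {ae leb, forall t, t < a -> w t = 0}.
Proof.
move=> mw iw wpsi.
have itv0 (c d : R) : d <= a -> (\int[leb]_(t in `]c, d[) (w t)%:E = 0)%E.
  move=> da.
  have ig : leb.-integrable setT ((fun t => `|w t|%:E) \_ `]-oo, a]%classic).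
    have ma : measurable (`]-oo, a]%classic : set (measurableTypeR R)) by [].
    exact: (integrable_mkcond _ ma).1 (integrable_norm (iw a)).
  have mE : measurable_fun setT (fun t => (w t * \1_(`]c, d[%classic) t)%:E).
    by apply/measurable_EFinP; apply: measurable_funM => //; exact: measurable_indic.
  have [] := @dominated_convergence _ _ _ leb setT measurableT
    (fun n (t : R) => (w t * plateau c d n t)%:E)
    (fun t : R => (w t * \1_(`]c, d[%classic) t)%:E)
    ((fun t => `|w t|%:E) \_ `]-oo, a]%classic) _ mE _ ig _.
  - move=> n; apply/measurable_EFinP; apply: measurable_funM => //.
    by apply: test_measurable; exact: test_plateau.
  - apply/aeW => t _; apply: cvg_EFin; first exact: nearW.
    by apply: cvgMr; exact: plateau_cvg.
  - apply/aeW => t n _; rewrite abse_EFin patchE normrM (ger0_norm (plateau_ge0 _ _ _ _)).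
    case: ifPn => [_|]; first by rewrite lee_fin ler_piMr// plateau_le1.
    rewrite notin_setE /= in_itv /= => /negP; rewrite -ltNge => at0.
    rewrite plateau_out ?mulr0// in_itv /= negb_and -!leNgt (le_trans da (ltW at0)).
    exact: orbT.
  move=> _ _; rewrite [X in X @ _](_ : _ = cst 0%E); last first.
    apply/funext => n; apply: wpsi; first exact: test_plateau.
    move=> x ax; rewrite plateau_out// in_itv /= negb_and -!leNgt (le_trans da ax).
    exact: orbT.
  move=> /cvg_lim-/(_ (@ereal_hausdorff R)); rewrite lim_cst//.
  move=> e0; rewrite integral_mkcond [RHS]e0; apply: eq_integral => t _.
  by rewrite patchE indicE; case: ifP; rewrite ?mulr1// mulr0.
have lw : locally_integrable setT w.
  split => //; first exact: openT.
  move=> K _ cK; have [M [_ KM]] := compact_bounded cK.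
  have KM1 x : K x -> x <= M + 1.
    by move=> Kx; apply: le_trans (ler_norm _) _; apply: KM => //; rewrite ltrDl.
  have /integrableP[mn] := integrable_norm (iw (M + 1)).
  apply: le_lt_trans.
  under [leRHS]eq_integral do rewrite /= normr_id.
  apply: ge0_subset_integral => //.
  exact: compact_measurable.
(* By Lebesgue differentiation [w] is almost everywhere the derivative of its primitive from [c],
   which vanishes up to [a]. The base points [c = - n] then exhaust the half-line. *)
have ft (c : R) : {ae leb, forall t, c < t < a -> w t = 0}.
  have ic y : leb.-integrable [set` Interval (BRight c) (BRight y)] (EFin \o w).
    have my : measurable (`]-oo, y]%classic : set (measurableTypeR R)) by [].
    apply: (integrableS my _ _ (iw y)) => // x /=.
    by rewrite !in_itv /= => /andP[].
  have := FTC1 ic lw; apply: ae_imply => t Ft /andP[ct ta].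
  have [_ <-] := Ft ct.
  rewrite derive1E (@near_eq_derive _ _ _ _ (cst 0)) ?derive_cst//.
  near=> y; rewrite /Rintegral -integral_itv_bndo_bndc; last first.
    exact/measurable_funTS/measurable_EFinP.
  rewrite itv0//; apply/ltW; near: y; exact: lt_nbhsl.
have := ae_foralln (fun n => ft (- n%:R)); apply: ae_imply => t H ta.
have [n tn] : exists n : nat, `|t| < n%:R by exists (Num.bound `|t|); exact: archi_boundP.
apply: (H n); rewrite ta andbT ltrNl; apply: le_lt_trans tn.
by rewrite -normrN ler_norm.
Unshelve. all: by end_near. Qed.

(** The integral of [psi] may be nonzero, so [Psi] is constant to the right of [a] but need not
    vanish there; subtracting a translate restores compact support. *)
Lemma test_primitive psi (a : R) : test_fun psi -> (forall x, a <= x -> psi x = 0) ->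
  exists Psi : R -> R, [/\ forall x : R, is_derive x 1 Psi (psi x),
    exists2 M : R, 0 < M & forall x, x < - M -> Psi x = 0 &
    forall x y, a <= x -> x <= y -> Psi x = Psi y].
Proof.
move=> tpsi psia; have [M M0 psi0] := test_support psi tpsi.
pose Psi x := \int[leb]_(t in `]-oo, x]) psi t.
have dPsi (x : R) : is_derive x 1 Psi (psi x).
  have [] := @continuous_FTC1 R psi -oo%O x (x + 1).
  - by rewrite ltrDl.
  - exact: (integrableS measurableT _ _ (test_integrable psi tpsi)).
  - by rewrite ltNyr.
  - exact: test_continuous.
  by rewrite derive1E => d e; split.
exists Psi; split => //.
  exists M => // x xM; rewrite /Psi /Rintegral integral0_eq// => t /=.
  rewrite in_itv /= => tx; rewrite psi0//.
  by rewrite -normrN (lt_le_trans _ (ler_norm _))// ltrNr (le_lt_trans tx).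
move=> x y ax xy; apply/esym/eqP; rewrite -subr_eq0; apply/eqP.
have [|z] := MVT_segment xy (fun c _ => dPsi c).
  by apply: derivable_within_continuous => c _; have [] := dPsi c.
by rewrite in_itv /= => /andP[xz _] ->; rewrite psia ?mul0r// (le_trans ax).
Qed.

(* [phi x] is the integral of [psi - psi (. + N)] over [(-oo, x]]. *)
Lemma test_shift psi (a : R) (N : nat) : test_fun psi -> (forall x, a <= x -> psi x = 0) ->
  exists phi, [/\ test_fun phi, derive1 phi = (fun x => psi x - psi (x + N%:R)) &
    forall x, a <= x -> phi x = 0].
Proof.
move=> tpsi psia; have [Psi [dPsi [M M0 Psi0] Psia]] := test_primitive psi a tpsi psia.
have N0 : (0 : R) <= N%:R by [].
pose phi x := Psi x - Psi (1 * x + N%:R).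
have phia x : a <= x -> phi x = 0.
  by move=> ax; rewrite /phi mul1r -(Psia x (x + N%:R)) ?subrr// lerDl.
have dphi (x : R) : is_derive x 1 phi (psi x - psi (x + N%:R)).
  have -> : phi = Psi \- (fun x => Psi (1 * x + N%:R)) by [].
  have := is_derive_comp_affine Psi _ 1 N%:R x (dPsi _).
  by rewrite !mul1r => d2; have := is_deriveB (dPsi x) d2.
have [dd dE] := derive1_eq phi _ dphi.
exists phi; split => //; split; last first.
  (* To the right of [a] the two values of [Psi] cancel; to the left of [- M - N] both vanish. *)
  exists (Num.max (M + N%:R) `|a|) => x; rewrite gt_max => /andP[xM xa].
  have [x0|x0] := leP 0 x.
    by apply: phia; move: xa; rewrite (ger0_norm x0) => /ltW; exact: le_trans (ler_norm _).
  move: xM; rewrite (ltr0_norm x0) => xM.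
  by rewrite /phi mul1r !Psi0 ?subrr//; lra.
apply/smoothnP => -[//|n] /=; split => //; rewrite dE.
have spsi : smoothn n psi by case: tpsi => /smoothnP.
have -> : (fun x => psi x - psi (x + N%:R)) = psi \+ (cst (-1) \* (fun x => psi (1 * x + N%:R))).
  by apply/funext => x /=; rewrite mulN1r mul1r.
apply: smoothnD => //; apply: smoothnM; first exact: smoothn_cst.
exact: smoothn_affine.
Qed.

(* [w] has vanishing weak derivative on [(-oo, a)], hence the same average
   against [psi] and all its translates to the left, where it is small. *)
Lemma weak_deriv0_before w (d : R -> R) (a : R) : measurable_fun setT w -> measurable_fun setT d ->
  (forall b, leb.-integrable `]-oo, b]%classic (EFin \o w)) ->
  (forall phi, test_fun phi ->
    (\int[leb]_t (w t * derive1 phi t)%:E = - \int[leb]_t (d t * phi t)%:E)%E) ->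
  {ae leb, forall t, t < a -> d t = 0} -> {ae leb, forall t, t < a -> w t = 0}.
Proof.
move=> mw md iw wd d0; apply: fundamental_lemma => // psi tpsi psia.
have iwM M : leb.-integrable `[- M, M]%classic (EFin \o w).
  have mM : measurable (`]-oo, M]%classic : set (measurableTypeR R)) by [].
  by apply: (integrableS mM _ _ (iw M)) => // x /=; rewrite !in_itv /= => /andP[].
have tshift (N : nat) : test_fun (fun x => psi (1 * x + N%:R)).
  split.
    by apply/smoothnP => n; apply: smoothn_affine; case: tpsi => /smoothnP.
  have [M M0 psi0] := test_support psi tpsi.
  exists (M + N%:R) => x Mx; apply: psi0; rewrite mul1r.
  have := ler_normB (x + N%:R) N%:R; rewrite addrK (ger0_norm (ler0n R N)); lra.
have mshift (N : nat) := test_measurable _ (tshift N).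
have eqN (N : nat) : (\int[leb]_t (w t * psi t)%:E = \int[leb]_t (w t * psi (1 * t + N%:R))%:E)%E.
  have [phi [tphi dphi phia]] := test_shift psi a N tpsi psia.
  have i1 := test_mul_integrable psi w tpsi mw iwM.
  have i2 := test_mul_integrable _ w (tshift N) mw iwM.
  have := wd phi tphi; rewrite [X in (- X)%E](_ : _ = 0%E); last first.
    rewrite (ae_eq_integral (cst 0%E)) ?integral0//.
      apply/measurable_EFinP; apply: measurable_funM => //; exact: test_measurable.
    move: d0; apply: ae_imply => t dt _ /=.
    by have [/dt ->|/phia ->] := ltP t a; rewrite ?mul0r ?mulr0.
  rewrite dphi oppe0.
  rewrite (_ : (\int[leb]_t _)%E = (\int[leb]_t ((w t * psi t)%:E -
    (w t * psi (1 * t + N%:R))%:E))%E); last first.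
    by apply: eq_integral => t _; rewrite mul1r mulrBr EFinB.
  rewrite (integralB measurableT i1 i2) => /eqP.
  by rewrite sube_eq ?add0e ?integrable_fin_num// => /eqP.
have [K K0 psiK] := test_bounded psi tpsi.
have ma : measurable (`]-oo, a]%classic : set (measurableTypeR R)) by [].
(* Translating to the left keeps the support of [psi] inside [(-oo, a]], so [K |w|] on that
   half-line dominates all the products, which tend to 0 pointwise. *)
have ig := (integrable_mkcond _ ma).1 (integrableZl ma K (integrable_norm (iw a))).
have [] := @dominated_convergence _ _ _ leb setT measurableT
    (fun (N : nat) (t : R) => (w t * psi (1 * t + N%:R))%:E) (cst 0%E) _ _ _ _ ig _.
- by move=> N; apply/measurable_EFinP; apply: measurable_funM => //; exact: mshift.
- exact: measurable_cst.
- apply/aeW => t _; apply: (@cvg_near_cst _ _ (0%E : \bar R)).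
  have [n tn] : exists n : nat, `|a - t| < n%:R by exists (Num.bound `|a - t|); exact: archi_boundP.
  exists n => // m /= nm; rewrite psia ?mulr0// mul1r -lerBlDl.
  by rewrite (le_trans (ler_norm _))// (le_trans (ltW tn))// ler_nat.
- apply/aeW => t N _; rewrite patchE; case: ifPn => [_|].
    rewrite -EFinM abse_EFin lee_fin normrM mulrC.
    by rewrite ler_wpM2r.
  rewrite notin_setE /= in_itv /= => /negP; rewrite -ltNge => at0.
  have -> : psi (1 * t + N%:R) = 0 by apply: psia; rewrite mul1r ler_wpDr// ltW.
  by rewrite mulr0 normr0.
move=> _ _; rewrite [X in X @ _](_ : _ = cst (\int[leb]_t (w t * psi t)%:E)%E); last first.
  by apply/funext => N; rewrite /= -eqN.
by move=> /cvg_lim-/(_ (@ereal_hausdorff R)); rewrite lim_cst// integral0.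
Qed.

End Variations.

(** * From scalar components to vectors *)

Section WeakVector.
Context {R : realType} {H : completeNormedModType R} (ip : H -> H -> R).
Hypothesis Hip : is_inner_product ip.

(** The null set depends on [h], so only countably many [h] may be used: the [d k] approximating the
    range of [w]. If [w t] is orthogonal to a [d k] closer to it than [|w t|], Cauchy-Schwarz forces
    [w t = 0]. *)
Lemma ae_ip_eq0 (w : R -> H) (P : R -> Prop) : smeasurable w ->
  (forall h, {ae leb, forall t, P t -> ip (w t) h = 0}) ->
  {ae leb, forall t, P t -> w t = 0}.
Proof.
move=> /smeasurable_separable[d [wd _]] ip0.
have := ae_foralln (fun k => ip0 (d k)); apply: ae_imply => t H0 Pt.
apply/eqP/negP => /negP wt0; have wp : 0 < `|w t| by rewrite normr_gt0.
have [k wk] := wd t _ wp.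
have : `|w t| ^+ 2 <= `|w t| * `|w t - d k|.
  rewrite -(ipxx ip Hip) -[leLHS]subr0 -(H0 k Pt) -(ipBr ip Hip).
  by apply: le_trans (ler_norm _) _; exact: cauchy_schwarz.
by rewrite expr2 ler_pM2l// leNgt wk.
Qed.

End WeakVector.

(** * Primitives of vector-valued functions *)

Section ExpIntegrals.
Context {R : realType}.
Implicit Types rho : R.

Lemma is_derive_expRM (c : R) (t : R) : is_derive t 1 (fun x => expR (c * x)) (c * expR (c * t)).
Proof.
have := is_derive_comp_affine expR (expR (c * t + 0)) c 0 t (is_derive_expR _).
rewrite addr0 (_ : (fun x => expR (c * x + 0)) = (fun x => expR (c * x)))//.
by apply/funext => x; rewrite addr0.
Qed.

Lemma continuous_expRM (c : R) : continuous (fun x => expR (c * x)).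
Proof.
move=> x; apply: differentiable_continuous; apply/derivable1_diffP.
by have [] := is_derive_expRM c x.
Qed.

Lemma integral_expR_tail rho s : 0 < rho ->
  (\int[leb]_(t in `[s, +oo[) (expR (- rho * t))%:E = (expR (- rho * s) / rho)%:E)%E.
Proof.
move=> rho0; have rhon0 : rho != 0 by rewrite gt_eqF.
pose F t := - rho^-1 * expR (- rho * t).
have dF (t : R) : is_derive t 1 F (expR (- rho * t)).
  have -> : F = (- rho^-1) \*: (fun x => expR (- rho * x)) by [].
  have := is_deriveZ (- rho^-1) (is_derive_expRM (- rho) t).
  by rewrite /GRing.scale /= mulrA mulrNN mulVf// mul1r.
rewrite (@ge0_continuous_FTC2y _ (fun t => expR (- rho * t)) F s 0).
- by rewrite sub0e /F -EFinN; congr EFin; rewrite mulNr opprK mulrC.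
- by move=> x _; rewrite expR_ge0.
- by apply: continuous_subspaceT; exact: continuous_expRM.
- rewrite /F -[X in _ --> X](mulr0 (- rho^-1)); apply: cvgMr.
  rewrite (_ : (fun x => expR (- rho * x)) = (fun z => expR (- z)) \o (fun z => rho * z)).
    apply: (@cvg_comp _ _ _ _ _ _ (pinfty_nbhs R)); last exact: cvgr_expR.
    exact: gt0_cvgMry.
  by apply/funext => x /=; rewrite mulNr.
- by move=> x _; have [] := dF x.
- apply: cvg_at_right_filter; apply: differentiable_continuous.
  by apply/derivable1_diffP; have [] := dF s.
- by move=> x _; rewrite derive1E; have [] := dF x.
Qed.

Lemma integral_expR_head rho t : 0 < rho ->
  (\int[leb]_(s in `]-oo, t]) (expR (rho * s))%:E = (expR (rho * t) / rho)%:E)%E.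
Proof.
move=> rho0; rewrite -{1}(opprK t) ge0_integration_by_substitutionNy.
- rewrite -{2}(opprK t) mulrN -mulNr -integral_expR_tail//.
  by apply: eq_integral => x _ /=; rewrite mulrN mulNr.
- by apply: continuous_subspaceT; exact: continuous_expRM.
- by move=> x _; rewrite expR_ge0.
Qed.

(** The choice [c = z / x] turns the family of Young inequalities into a Cauchy-Schwarz
    inequality. *)
Lemma sqr_le_of_young (x y z : R) : 0 <= x -> 0 <= y -> 0 < z ->
  (forall c, 0 < c -> 2 * x <= c * y + z / c) -> x ^+ 2 <= y * z.
Proof.
move=> x0 y0 z0 H; have [->|xn0] := eqVneq x 0.
  by rewrite expr0n /= mulr_ge0// ltW.
have xp : 0 < x by rewrite lt_neqAle eq_sym xn0.
have := H (z / x) (divr_gt0 z0 xp).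
have -> : z / (z / x) = x by field; rewrite !gt_eqF.
rewrite -lerBlDr (_ : 2 * x - x = x); last by ring.
by rewrite -ler_pdivlMr// mulrAC (mulrC z).
Qed.

(* Cauchy-Schwarz for [f e^(-rho s/2)] and [e^(rho s/2)]. *)
Lemma weighted_cauchy_schwarz rho (D : set R) (f : R -> R) (y z : R) :
  measurable D -> measurable_fun setT f -> (forall s, 0 <= f s) -> 0 <= y -> 0 < z ->
  (\int[leb]_(s in D) (expR (rho * s))%:E <= z%:E)%E ->
  (\int[leb]_(s in D) (f s ^+ 2 * expR (- rho * s))%:E <= y%:E)%E ->
  leb.-integrable D (EFin \o f) /\ (\int[leb]_(s in D) f s) ^+ 2 <= y * z.
Proof.
move=> mD mf f0 y0 z0 Zz Yy.
have me (c : R) : measurable_fun setT (fun s : R => expR (c * s)).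
  by apply: continuous_measurable_fun; exact: continuous_expRM.
have mfE : measurable_fun D (EFin \o f).
  by apply: measurable_funTS; exact/measurable_EFinP.
have mY : measurable_fun D (fun s => (f s ^+ 2 * expR (- rho * s))%:E).
  by apply: measurable_funTS; apply/measurable_EFinP; apply: measurable_funM => //;
    exact: measurable_funX.
have mZ : measurable_fun D (fun s => (expR (rho * s))%:E).
  by apply: measurable_funTS; exact/measurable_EFinP.
(* Young's inequality under the integral. The case [c = 1] already gives integrability; all [c]
   together give the bound on the square. *)
have key c : 0 < c -> (2%:E * \int[leb]_(s in D) (f s)%:E <= (c * y + z / c)%:E)%E.
  move=> c0; have c'0 : 0 <= c^-1 by rewrite invr_ge0 ltW.
  rewrite -ge0_integralZl_EFin//; last by move=> s _; rewrite lee_fin.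
  apply: (@le_trans _ _ (\int[leb]_(s in D) (c%:E * (f s ^+ 2 * expR (- rho * s))%:E +
     c^-1%:E * (expR (rho * s))%:E))%E).
    apply: ge0_le_integral => //.
    - by move=> s _; rewrite -EFinM lee_fin mulr_ge0.
    - exact: measurable_funeM.
    - by apply: emeasurable_funD; exact: measurable_funeM.
    - move=> s _; rewrite -!EFinM -EFinD lee_fin mulNr expRN.
      have := expR_gt0 (rho * s); move: (expR _) => E E0.
      rewrite -subr_ge0 (_ : _ - _ = (c * f s - E) ^+ 2 / (c * E)); last first.
        by field; rewrite !gt_eqF.
      by rewrite divr_ge0 ?sqr_ge0// mulr_ge0 ?ltW.
  rewrite ge0_integralD//; first last.
  - exact: measurable_funeM.
  - by move=> s _; rewrite -EFinM lee_fin mulr_ge0 ?expR_ge0.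
  - exact: measurable_funeM.
  - by move=> s _; rewrite -EFinM lee_fin !mulr_ge0 ?expR_ge0 ?(ltW c0).
  rewrite !ge0_integralZl_EFin// ?(ltW c0)//; first last.
  - by move=> s _; rewrite lee_fin mulr_ge0 ?expR_ge0// sqr_ge0.
  rewrite EFinD (EFinM c) (mulrC z) EFinM.
  by apply: leeD; apply: lee_wpmul2l; rewrite ?lee_fin// ltW.
have X0 : (0 <= \int[leb]_(s in D) (f s)%:E)%E.
  by apply: integral_ge0 => s _; rewrite lee_fin.
have Xfin : (\int[leb]_(s in D) (f s)%:E < +oo)%E.
  apply: le_lt_trans (le_lt_trans (key 1 ltr01) (ltry _)).
  by rewrite -{1}(mul1e (\int[_]_(_ in _) _)%E) lee_wpmul2r// lee_fin ler1n.
have XE : (\int[leb]_(s in D) (f s)%:E = (\int[leb]_(s in D) f s)%:E)%E.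
  by rewrite /Rintegral fineK// ge0_fin_numE.
split.
  apply/integrableP; split => //.
  by under eq_integral => s _ do rewrite /= ger0_norm//.
apply: sqr_le_of_young => //; first by rewrite -lee_fin -XE.
by move=> c /key; rewrite XE -EFinM lee_fin.
Qed.

End ExpIntegrals.

(** * Vector integrals and primitives from [-oo] *)

Section Antiderivative.
Context {R : realType} {H : completeNormedModType R} (ip : H -> H -> R).
Hypothesis Hip : is_inner_product ip.
Implicit Types (f g u : R -> H) (rho : R).

Lemma measurable_ip f h : smeasurable f -> measurable_fun setT (fun t => ip (f t) h).
Proof.
move=> /smeasurable_separable[d [_ mf]].
under eq_fun do rewrite (ip_polar ip Hip).
apply: measurable_funM => //; apply: measurable_funB; last exact: measurable_funX.
by apply: measurable_funD => //; exact: measurable_funX.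
Qed.

Lemma integrable_ip (D : set (measurableTypeR R)) f h : measurable D -> smeasurable f ->
  leb.-integrable D (fun t => `|f t|%:E) ->
  leb.-integrable D (EFin \o (fun t => ip (f t) h)).
Proof.
move=> mD mf iF.
apply: (le_integrable mD _ _ (integrableZl mD `|h| iF)).
  by apply: measurable_funTS; apply/measurable_EFinP; exact: measurable_ip.
move=> t _; rewrite -EFinM !abse_EFin lee_fin normrM !normr_id mulrC.
exact: cauchy_schwarz.
Qed.

(** Take [h = v] and divide by [|v|]. *)
Lemma norm_le_integral (D : set (measurableTypeR R)) f (v : H) : measurable D -> smeasurable f ->
  leb.-integrable D (fun t => `|f t|%:E) ->
  (forall h, ip v h = \int[leb]_(s in D) ip (f s) h) ->
  `|v| <= \int[leb]_(s in D) `|f s|.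
Proof.
move=> mD mf iF vE; have [->|v0] := eqVneq v 0.
  by rewrite normr0; apply: Rintegral_ge0.
have nv : 0 < `|v| by rewrite normr_gt0.
rewrite -(ler_pM2r nv) -expr2 -(ipxx ip Hip) vE.
apply: le_trans (ler_norm _) _.
apply: le_trans (le_normr_Rintegral mD (integrable_ip D f v mD mf iF)) _.
rewrite -RintegralZr//; apply: le_Rintegral => //.
- by have := integrable_norm (integrable_ip D f v mD mf iF).
- exact: (integrableZr mD `|v| iF).
- by move=> s _; exact: cauchy_schwarz.
Qed.

Lemma bochner_integral_exists (D : set (measurableTypeR R)) f : measurable D -> smeasurable f ->
  leb.-integrable D (fun t => `|f t|%:E) ->
  exists v, forall h, ip v h = \int[leb]_(s in D) ip (f s) h.
Proof.
move=> mD mf iF; have iip h := integrable_ip D f h mD mf iF.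
apply: (riesz ip Hip (fun h => \int[leb]_(s in D) ip (f s) h)
  (\int[leb]_(s in D) `|f s|)) => [a x y|h].
  rewrite -RintegralZl// -RintegralD//; last exact: (integrableZl mD a (iip x)).
  by apply: eq_Rintegral => s _; rewrite (ipDr ip Hip) (ipZr ip Hip).
apply: le_trans (le_normr_Rintegral mD (iip h)) _.
rewrite -RintegralZr//; apply: le_Rintegral => //.
- by have := integrable_norm (iip h).
- exact: (integrableZr mD `|h| iF).
- by move=> s _; exact: cauchy_schwarz.
Qed.

(** The weight [expR (- rho s)] has half the exponent found in [energy], as
    [weighted_cauchy_schwarz] requires; the missing factor [expR (rho s)] is bounded on [s <= b]. *)
Lemma head_energy_le rho g (D : set (measurableTypeR R)) b : 0 < rho -> inL2 rho g -> measurable D ->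
  D `<=` `]-oo, b]%classic ->
  (\int[leb]_(s in D) (`|g s| ^+ 2 * expR (- rho * s))%:E <=
   (expR (rho * b) * fine (energy rho g))%:E)%E.
Proof.
move=> rho0 /inL2E[mg eg] mD Db; rewrite EFinM fineK ?ge0_fin_numE ?energy_ge0//.
have me (c : R) : measurable_fun setT (fun s : R => expR (c * s)).
  by apply: continuous_measurable_fun; exact: continuous_expRM.
have mE := measurable_energy rho g mg.
rewrite /energy -ge0_integralZl_EFin ?expR_ge0//.
apply: (@le_trans _ _ (\int[leb]_(t in D)
    ((expR (rho * b))%:E * ((`|g t| * expR (- (rho * t))) ^+ 2)%:E))%E); last first.
  apply: ge0_subset_integral => //.
  exact: measurable_funeM.
apply: ge0_le_integral => //.
- apply: measurable_funTS; apply/measurable_EFinP; apply: measurable_funM; last exact: me.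
  by apply: measurable_funX; exact: smeasurable_norm.
- by apply: measurable_funTS; exact: measurable_funeM.
move=> s /Db /=; rewrite in_itv /= => sb; rewrite -EFinM lee_fin exprMn mulrCA ler_wpM2l ?sqr_ge0//.
rewrite expr2 -!expRD ler_expR.
have : rho * s <= rho * b by rewrite ler_pM2l.
lra.
Qed.

Lemma head_integrable rho g (D : set (measurableTypeR R)) b : 0 < rho -> inL2 rho g -> measurable D ->
  D `<=` `]-oo, b]%classic -> leb.-integrable D (fun t => `|g t|%:E).
Proof.
move=> rho0 g2 mD Db; have [mg _] := g2.
have mng := smeasurable_norm g mg.
have mb : measurable (`]-oo, b]%classic : set (measurableTypeR R)) by [].
apply: (integrableS mb mD Db).
have [] // := @weighted_cauchy_schwarz R rho `]-oo, b]%classic (fun t => `|g t|)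
  (expR (rho * b) * fine (energy rho g)) (expR (rho * b) / rho).
- by rewrite mulr_ge0 ?expR_ge0// fine_ge0// energy_ge0.
- by rewrite divr_gt0// expR_gt0.
- by rewrite integral_expR_head.
- exact: head_energy_le.
Qed.

(** The vector integral of [g] up to [t], read off against all [h]. Starting from [-oo] fixes the
    integration constant. *)
Definition is_primitive g u := forall t h, ip (u t) h = \int[leb]_(s in `]-oo, t]) ip (g s) h.

Lemma primitive_exists rho g : 0 < rho -> inL2 rho g -> exists u, is_primitive g u.
Proof.
move=> rho0 g2; have [mg _] := g2.
have /choice[u ug] : forall t, exists v, forall h, ip v h = \int[leb]_(s in `]-oo, t]) ip (g s) h.
  move=> t; apply: bochner_integral_exists => //; exact: (head_integrable rho g _ t).
by exists u.
Qed.

Lemma primitive_norm_le rho g u t : 0 < rho -> inL2 rho g -> is_primitive g u ->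
  `|u t| <= \int[leb]_(s in `]-oo, t]) `|g s|.
Proof.
move=> rho0 g2 ug; have [mg _] := g2.
by apply: norm_le_integral => //; exact: (head_integrable rho g _ t).
Qed.

(** Cauchy-Schwarz on []s, t]], where [expR (rho x)] is at most [expR (rho b)]. The exponent [1 / 2]
    yields continuity, hence strong measurability of a primitive built by pointwise choice. *)
Lemma primitive_hoelder rho g u b s t : 0 < rho -> inL2 rho g -> is_primitive g u ->
  s < t -> t <= b -> `|u t - u s| ^+ 2 <=
    expR (rho * b) * fine (energy rho g) * expR (rho * b) * (t - s).
Proof.
move=> rho0 g2 ug st tb; have [mg _] := g2.
have mng := smeasurable_norm g mg.
have mD : measurable (`]s, t]%classic : set (measurableTypeR R)) by [].
have Db : `]s, t]%classic `<=` `]-oo, b]%classic.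
  by move=> x /=; rewrite !in_itv /= => /andP[_ xt]; exact: le_trans xt tb.
have [|||||iD le] := @weighted_cauchy_schwarz R rho `]s, t]%classic (fun t => `|g t|)
  (expR (rho * b) * fine (energy rho g)) ((t - s) * expR (rho * b)) mD mng.
- by [].
- by rewrite mulr_ge0 ?expR_ge0// fine_ge0// energy_ge0.
- by rewrite mulr_gt0 ?expR_gt0// subr_gt0.
- apply: (@le_trans _ _ (\int[leb]_(x in `]s, t]) (cst (expR (rho * b))%:E x))%E).
    apply: ge0_le_integral => //.
    + apply: measurable_funTS; apply/measurable_EFinP.
      by apply: continuous_measurable_fun; exact: continuous_expRM.
    + move=> x /Db /=; rewrite in_itv /= => xb.
      by rewrite lee_fin ler_expR ler_pM2l.
  have lst := @lebesgue_measure_itv R `]s, t]; rewrite /= lte_fin st -EFinB in lst.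
  rewrite integral_cst// [X in (_ * X)%E](_ : _ = (t - s)%:E); last exact: lst.
  by rewrite -EFinM lee_fin mulrC.
- exact: head_energy_le.
rewrite -mulrA (mulrC (expR _) (t - s)); apply: le_trans le; rewrite ler_sqr ?nnegrE ?Rintegral_ge0//.
apply: norm_le_integral => // h; rewrite (ipBl ip Hip) !ug.
apply: Rintegral_itvB => //; last by rewrite bnd_simp ltW.
apply: integrable_ip => //; exact: (head_integrable rho g _ t).
Qed.

Lemma primitive_continuous rho g u : 0 < rho -> inL2 rho g -> is_primitive g u -> continuous u.
Proof.
move=> rho0 g2 ug x; apply/cvgrPdist_lt => e e0.
pose K := expR (rho * (x + 1)) * fine (energy rho g) * expR (rho * (x + 1)).
have K0 : 0 <= K by rewrite !mulr_ge0 ?expR_ge0// fine_ge0// energy_ge0.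
have hold y : `|x - y| < 1 -> `|u x - u y| ^+ 2 <= K * `|x - y|.
  move=> xy; have [yx|xy'|->] := ltgtP y x; last by rewrite !subrr !normr0 expr0n mulr0.
    rewrite (gtr0_norm (_ : 0 < x - y)) ?subr_gt0//.
    have := primitive_hoelder rho g u (x + 1) y x rho0 g2 ug yx.
    by rewrite lerDl ler01 => /(_ isT).
  rewrite distrC (distrC x) (gtr0_norm (_ : 0 < y - x)) ?subr_gt0//.
  have := primitive_hoelder rho g u (x + 1) x y rho0 g2 ug xy'.
  have -> : y <= x + 1.
    by move: xy; rewrite distrC => /(le_lt_trans (ler_norm _)); lra.
  by move=> /(_ isT).
have d0 : 0 < e ^+ 2 / (K + 1) by rewrite divr_gt0 ?exprn_gt0// ltr_pwDr.
exists (Num.min 1 (e ^+ 2 / (K + 1))); first by rewrite /= lt_min ltr01 d0.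
move=> y /=; rewrite lt_min => /andP[y1 ye].
rewrite -ltr_sqr ?nnegrE ?(ltW e0)//; apply: le_lt_trans (hold y y1) _.
apply: (@le_lt_trans _ _ ((K + 1) * `|x - y|)); first by rewrite ler_wpM2r// lerDl.
by rewrite mulrC -ltr_pdivlMr// ltr_pwDr.
Qed.

Lemma primitive_smeasurable rho g u : 0 < rho -> inL2 rho g -> is_primitive g u ->
  smeasurable u.
Proof. by move=> rho0 g2 ug; apply: continuous_smeasurable; exact: (primitive_continuous rho g). Qed.

(** Integrand on the half-plane [s <= t] for exchanging integrals; [K] will be an exponential weight
    or the derivative of a test function. *)
Definition triangle (G K : R -> R) (p : measurableTypeR R * measurableTypeR R) : R :=
  if p.1 <= p.2 then G p.1 * K p.2 else 0.

Lemma measurable_triangle G K : measurable_fun setT G -> measurable_fun setT K ->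
  measurable_fun setT (triangle G K).
Proof.
move=> mG mK; apply: measurable_fun_ifT.
- by apply: measurable_fun_ler; [exact: measurable_fst|exact: measurable_snd].
- apply: measurable_funM.
    by apply: (measurableT_comp mG); exact: measurable_fst.
  by apply: (measurableT_comp mK); exact: measurable_snd.
- exact: measurable_cst.
Qed.

Lemma integral_triangle1 G K t : (\int[leb]_s (triangle G K (s, t))%:E =
  \int[leb]_(s in `]-oo, t]) (G s * K t)%:E)%E.
Proof.
rewrite [RHS]integral_mkcond; apply: eq_integral => s _; rewrite patchE /triangle /=.
case: leP => st; first by rewrite mem_set.
by rewrite memNset//= in_itv /= leNgt st.
Qed.

Lemma integral_triangle2 G K s : (\int[leb]_t (triangle G K (s, t))%:E =
  \int[leb]_(t in `[s, +oo[) (G s * K t)%:E)%E.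
Proof.
rewrite [RHS]integral_mkcond; apply: eq_integral => t _; rewrite patchE /triangle /=.
case: leP => st; first by rewrite mem_set//= in_itv /= st.
by rewrite memNset//= in_itv /= leNgt st.
Qed.

(** Cauchy-Schwarz with the weight split in halves bounds [|u t|^2] by [expR (rho t) / rho] times
    the integral of [G] up to [t]. After multiplication by [expR (- 2 rho t)], Tonelli's theorem
    leaves the tail integral of [expR (- rho t)] from [s], which supplies the second factor
    [1 / rho]. *)
Lemma primitive_energy_le rho g u : 0 < rho -> inL2 rho g -> is_primitive g u ->
  (energy rho u <= (rho ^- 2)%:E * energy rho g)%E.
Proof.
move=> rho0 g2 ug; have [mg _] := g2.
have mng := smeasurable_norm g mg.
have mu := primitive_smeasurable rho g u rho0 g2 ug.
have me (c : R) : measurable_fun setT (fun s : R => expR (c * s)).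
  by apply: continuous_measurable_fun; exact: continuous_expRM.
pose G s := `|g s| ^+ 2 * expR (- rho * s).
pose K t : R := expR (- rho * t).
have mG : measurable_fun setT G by apply: measurable_funM => //; exact: measurable_funX.
have mtri : measurable_fun setT (EFin \o triangle G K).
  by apply/measurable_EFinP; apply: measurable_triangle => //; exact: me.
have tri0 p : (0 <= (EFin \o triangle G K) p)%E.
  by rewrite /triangle /= lee_fin; case: ifP => // _; rewrite !mulr_ge0 ?sqr_ge0 ?expR_ge0.
have rho'0 : 0 <= rho^-1 by rewrite invr_ge0 ltW.
apply: (@le_trans _ _ (rho^-1%:E * \int[leb]_t \int[leb]_s (triangle G K (s, t))%:E)%E).
  rewrite -ge0_integralZl_EFin//; first last.
  - exact: (@measurable_fun_fubini_tonelli_G _ _ _ _ _ leb (EFin \o triangle G K)).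
  - by move=> t _; apply: integral_ge0 => s _; exact: (tri0 (s, t)).
  apply: ge0_le_integral => //.
  - exact: measurable_energy.
  - apply: measurable_funeM.
    exact: (@measurable_fun_fubini_tonelli_G _ _ _ _ _ leb (EFin \o triangle G K)).
  move=> t _; rewrite integral_triangle1.
  under eq_integral do rewrite mulrC EFinM.
  have mGt : measurable_fun `]-oo, t]%classic (EFin \o G).
    by apply: measurable_funTS; exact/measurable_EFinP.
  rewrite ge0_integralZl_EFin ?expR_ge0//; last first.
    by move=> s _; rewrite lee_fin mulr_ge0 ?sqr_ge0 ?expR_ge0.
  have Y0 : (0 <= \int[leb]_(s in `]-oo, t]) (G s)%:E)%E.
    by apply: integral_ge0 => s _; rewrite lee_fin mulr_ge0 ?sqr_ge0 ?expR_ge0.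
  have Yfin : (\int[leb]_(s in `]-oo, t]) (G s)%:E < +oo)%E.
    by apply: le_lt_trans (head_energy_le rho g _ t rho0 g2 _ _) (ltry _).
  have YE : (\int[leb]_(s in `]-oo, t]) (G s)%:E = (\int[leb]_(s in `]-oo, t]) G s)%:E)%E.
    by rewrite /Rintegral fineK// ge0_fin_numE.
  have [||||||_ cs] := @weighted_cauchy_schwarz R rho `]-oo, t]%classic (fun t => `|g t|)
    (\int[leb]_(s in `]-oo, t]) G s) (expR (rho * t) / rho) _ mng.
  - by [].
  - by [].
  - by rewrite -lee_fin -YE.
  - by rewrite divr_gt0// expR_gt0.
  - by rewrite integral_expR_head.
  - by rewrite -YE.
  rewrite YE -!EFinM lee_fin exprMn.
  apply: (@le_trans _ _ ((\int[leb]_(s in `]-oo, t]) `|g s|) ^+ 2 * expR (- (rho * t)) ^+ 2)).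
    rewrite ler_wpM2r ?sqr_ge0// ler_sqr ?nnegrE ?Rintegral_ge0//.
    exact: (primitive_norm_le rho).
  apply: (@le_trans _ _ ((\int[leb]_(s in `]-oo, t]) G s) * (expR (rho * t) / rho) * expR (- (rho * t)) ^+ 2)).
    by rewrite ler_wpM2r ?sqr_ge0.
  rewrite /K mulNr expRN le_eqVlt; apply/orP; left; apply/eqP.
  by field; rewrite !gt_eqF ?expR_gt0.
rewrite -(@fubini_tonelli _ _ _ _ _ leb leb (EFin \o triangle G K) mtri tri0).
under eq_integral => s _.
  rewrite /= integral_triangle2.
  under eq_integral do rewrite EFinM.
  rewrite ge0_integralZl_EFin//; first last.
  - by rewrite mulr_ge0 ?sqr_ge0 ?expR_ge0.
  - by apply: measurable_funTS; apply/measurable_EFinP; exact: me.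
  - by move=> t _; rewrite lee_fin expR_ge0.
  rewrite integral_expR_tail// -EFinM.
  over.
rewrite -exprVn expr2 EFinM -muleA.
apply: lee_wpmul2l; first by rewrite lee_fin.
rewrite /energy -ge0_integralZl_EFin//; last exact: measurable_energy.
rewrite le_eqVlt; apply/orP; left; apply/eqP; apply: eq_integral => s _.
rewrite -EFinM; congr EFin; rewrite /G mulNr exprMn; field.
by rewrite gt_eqF.
Qed.

(** Fubini's theorem on [s <= t]: the derivative of [phi] integrates to [- phi s] over
    [[s, +oo)]. *)
Lemma primitive_weak_deriv rho g u : 0 < rho -> inL2 rho g -> is_primitive g u ->
  weak_deriv ip u g.
Proof.
move=> rho0 g2 ug h phi tphi; have [mg _] := g2.
have tphi' := test_derive1 phi tphi.
have [M M0 phi0] := test_support _ tphi'.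
have mphi' := test_measurable _ tphi'.
pose G s := ip (g s) h.
have mG : measurable_fun setT G by exact: measurable_ip.
have iG t : leb.-integrable `]-oo, t]%classic (EFin \o G).
  by apply: integrable_ip => //; exact: (head_integrable rho g _ t).
have mtri : measurable_fun setT (EFin \o triangle G (derive1 phi)).
  by apply/measurable_EFinP; exact: measurable_triangle.
(* The derivative of [phi] lives in [|t| <= M], so wherever it is nonzero the integral of [|G|] up
   to [t] is at most [c]. *)
pose c := \int[leb]_(s in `]-oo, M]) `|G s|.
have iphi : leb.-integrable setT (fun t => (c%:E * `|derive1 phi t|%:E)%E).
  by apply: integrableZl => //; exact: (integrable_norm (test_integrable _ tphi')).
have itri : (leb \x leb)%E.-integrable setT (EFin \o triangle G (derive1 phi)).
  apply/(integrable21ltyP leb leb mtri).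
  have := integrable_lty measurableT iphi; apply: le_lt_trans.
  apply: ge0_le_integral => //.
  - by move=> t _; apply: integral_ge0 => s _; exact: abse_ge0.
  - by apply: (@measurable_fun_fubini_tonelli_G _ _ _ _ _ leb
      (fun p => `|(EFin \o triangle G (derive1 phi)) p|%E)) => //; exact: measurableT_comp.
  - by have /measurable_int := iphi.
  move=> t _.
  rewrite (_ : (\int[leb]_s _)%E =
    (\int[leb]_s (triangle (fun s => `|G s|) (fun t => `|derive1 phi t|) (s, t))%:E)%E); last first.
    apply: eq_integral => s _; rewrite /triangle /=.
    by case: ifP => _; rewrite ?normr0// normrM.
  rewrite integral_triangle1.
  have [tM|tM] := leP `|t| M; last first.
    by rewrite phi0// normr0 mule0; under eq_integral do rewrite mulr0; rewrite integral0.
  under eq_integral do rewrite mulrC EFinM.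
  rewrite ge0_integralZl_EFin//; last first.
    by apply: measurable_funTS; apply/measurable_EFinP; exact: measurableT_comp.
  rewrite muleC; apply: lee_wpmul2r; first by rewrite lee_fin.
  have iGn := integrable_norm (iG M).
  rewrite /c /Rintegral fineK; last exact: integrable_fin_num.
  apply: ge0_subset_integral => //; first by have /measurable_int := iGn.
  move=> s /=; rewrite !in_itv /= => /le_trans; apply.
  exact: le_trans (ler_norm _) tM.
have L : (\int[leb]_t (ip (u t) h * derive1 phi t)%:E =
   \int[leb]_t \int[leb]_s (EFin \o triangle G (derive1 phi)) (s, t))%E.
  apply: eq_integral => t _; rewrite /= integral_triangle1.
  under [RHS]eq_integral do rewrite mulrC EFinM.
  rewrite integralZl//; rewrite ug /Rintegral EFinM fineK 1?muleC//.
  exact: integrable_fin_num.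
rewrite L -(Fubini itri).
have iGphi : leb.-integrable setT (fun t => (G t * phi t)%:E).
  apply: test_mul_integrable => // m.
  have mm : measurable (`]-oo, m]%classic : set (measurableTypeR R)) by [].
  apply: (integrableS mm _ _ (iG m)) => // s /=.
  by rewrite !in_itv /= => /andP[].
rewrite -integralN; last exact: integrable_add_def.
apply: eq_integral => s _; rewrite /= integral_triangle2.
under eq_integral do rewrite EFinM.
rewrite integralZl//; last by apply: integrableS (test_integrable _ tphi').
by rewrite test_integral_derive1_tail// -EFinM mulrN.
Qed.

End Antiderivative.

(** * Weak derivatives *)

Section WeakDerivative.
Context {R : realType} {H : completeNormedModType R} (ip : H -> H -> R).
Hypothesis Hip : is_inner_product ip.
Implicit Types (rho : R) (f g u v w : R -> H).

Lemma inL2_ip_integrable rho f h b : 0 < rho -> inL2 rho f ->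
  leb.-integrable `]-oo, b]%classic (EFin \o (fun t => ip (f t) h)).
Proof.
move=> rho0 f2; have [mf _] := f2.
by apply: integrable_ip => //; exact: (head_integrable rho f _ b).
Qed.

Lemma inL2_test_integrable rho f h phi : 0 < rho -> inL2 rho f -> test_fun phi ->
  leb.-integrable setT (fun t => (ip (f t) h * phi t)%:E).
Proof.
move=> rho0 f2 tphi; have [mf _] := f2.
apply: (test_mul_integrable phi (fun t => ip (f t) h)) => //; first exact: measurable_ip.
move=> M; have mM : measurable (`]-oo, M]%classic : set (measurableTypeR R)) by [].
apply: (integrableS mM _ _ (inL2_ip_integrable rho f h M rho0 f2)) => // x /=.
by rewrite !in_itv /= => /andP[].
Qed.

Lemma has_deriv_fsub rho u g v k : 0 < rho ->
  has_deriv ip rho u g -> has_deriv ip rho v k -> has_deriv ip rho (fsub u v) (fsub g k).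
Proof.
move=> rho0 [u2 g2 ug] [v2 k2 vk]; split; [exact: inL2_fsub|exact: inL2_fsub|].
move=> h phi tphi; have tphi' := test_derive1 phi tphi.
have split_int (f f' : R -> H) (psi : R -> R) : inL2 rho f -> inL2 rho f' -> test_fun psi ->
  (\int[leb]_t (ip (fsub f f' t) h * psi t)%:E =
   \int[leb]_t (ip (f t) h * psi t)%:E - \int[leb]_t (ip (f' t) h * psi t)%:E)%E.
  move=> f2 f2' tpsi.
  rewrite -(integralB measurableT (inL2_test_integrable rho f h psi rho0 f2 tpsi)
    (inL2_test_integrable rho f' h psi rho0 f2' tpsi)).
  by apply: eq_integral => t _; rewrite /fsub (ipBl ip Hip) mulrBl.
rewrite !split_int// ug// vk// oppeK fin_num_oppeB//.
by rewrite integrable_fin_num//; exact: (inL2_test_integrable rho).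
Qed.

Lemma deriv0_before rho w d (a : R) : 0 < rho -> has_deriv ip rho w d ->
  {ae leb, forall t, t < a -> d t = 0} -> {ae leb, forall t, t < a -> w t = 0}.
Proof.
move=> rho0 [w2 d2 wd] d0; have [mw _] := w2; have [md _] := d2.
apply: (ae_ip_eq0 ip Hip) => // h.
apply: (weak_deriv0_before _ (fun t => ip (d t) h)).
- exact: measurable_ip.
- exact: measurable_ip.
- by move=> b; exact: (inL2_ip_integrable rho).
- by move=> phi tphi; exact: wd.
- by apply: ae_imply d0 => t dt /dt ->; rewrite (ip0l ip Hip).
Qed.

Lemma ae_neq (a : R) : {ae leb, forall t : R, t <> a}.
Proof.
exists [set a]; split => //; first exact: lebesgue_measure_set1.
by move=> t /= /contrapT.
Qed.

Lemma before0_deriv rho w d (a : R) : 0 < rho -> has_deriv ip rho w d ->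
  {ae leb, forall t, t < a -> w t = 0} -> {ae leb, forall t, t < a -> d t = 0}.
Proof.
move=> rho0 [w2 d2 wd] w0; have [mw _] := w2; have [md _] := d2.
apply: (ae_ip_eq0 ip Hip) => // h.
apply: fundamental_lemma => [||psi tpsi psia]; first exact: measurable_ip.
  by move=> b; exact: (inL2_ip_integrable rho).
have := wd h psi tpsi; rewrite (ae_eq_integral (cst 0%E)) ?integral0//.
- by move=> /eqP; rewrite eq_sym oppe_eq0 => /eqP.
- by have /measurable_int := inL2_test_integrable rho w h _ rho0 w2 (test_derive1 psi tpsi).
- move: (ae_imply2 _ _ _ (fun t P Q => conj P Q) w0 (ae_neq a)); apply: ae_imply => t [wt ta] _ /=.
  have [/wt ->|at0] := ltP t a; first by rewrite (ip0l ip Hip) mul0r.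
  have {}at0 : a < t by rewrite lt_neqAle at0 andbT; apply/eqP => /esym.
  rewrite derive1E (@near_eq_derive _ _ _ _ (cst 0)) ?derive_cst ?mulr0//.
  by near=> y; rewrite psia//; apply/ltW; near: y; exact: lt_nbhsr.
Unshelve. all: by end_near. Qed.

Lemma aeq_before_forall {T : Type} (f g : R -> T) : (forall a, aeq_before a f g) -> aeq f g.
Proof.
move=> fg; have := ae_foralln (fun n => fg n%:R); apply: ae_imply => t H0.
have [n tn] : exists n : nat, `|t| < n%:R by exists (Num.bound `|t|); exact: archi_boundP.
by apply: (H0 n); exact: le_lt_trans (ler_norm _) tn.
Qed.

Lemma aeq_beforeP (a : R) f g : aeq_before a f g <->
  {ae leb, forall t, t < a -> fsub f g t = 0}.
Proof.
split; apply: ae_imply => t fg /fg; rewrite /fsub; first by move=> ->; rewrite subrr.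
by move=> /eqP; rewrite subr_eq0 => /eqP.
Qed.

Lemma deriv_eq_before rho u g v k (a : R) : 0 < rho ->
  has_deriv ip rho u g -> has_deriv ip rho v k -> aeq_before a g k -> aeq_before a u v.
Proof.
move=> rho0 ug vk /aeq_beforeP gk; apply/aeq_beforeP.
exact: (deriv0_before rho _ _ a rho0 (has_deriv_fsub rho _ _ _ _ rho0 ug vk)).
Qed.

Lemma eq_deriv_before rho u g v k (a : R) : 0 < rho ->
  has_deriv ip rho u g -> has_deriv ip rho v k -> aeq_before a u v -> aeq_before a g k.
Proof.
move=> rho0 ug vk /aeq_beforeP uv; apply/aeq_beforeP.
exact: (before0_deriv rho _ _ a rho0 (has_deriv_fsub rho _ _ _ _ rho0 ug vk)).
Qed.

Lemma primitive_has_deriv rho g u : 0 < rho -> inL2 rho g -> is_primitive ip g u ->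
  has_deriv ip rho u g.
Proof.
move=> rho0 g2 ug; split => //; last exact: (primitive_weak_deriv ip Hip rho).
apply/inL2E; split; first exact: (primitive_smeasurable ip Hip rho g).
apply: le_lt_trans (primitive_energy_le ip Hip rho g u rho0 g2 ug) _.
have [_ eg] := (inL2E _ _).1 g2.
by rewrite lte_mul_pinfty// lee_fin invr_ge0 exprn_ge0// ltW.
Qed.

Lemma deriv_exists rho g : 0 < rho -> inL2 rho g -> exists u, has_deriv ip rho u g.
Proof.
move=> rho0 g2; have [u ug] := primitive_exists ip Hip rho g rho0 g2.
by exists u; exact: primitive_has_deriv.
Qed.

(** A weak derivative determines its function in the space, so [u] agrees almost everywhere with the
    primitive of [g] from [-oo]. *)
Lemma deriv_energy_le rho u g : 0 < rho -> has_deriv ip rho u g ->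
  (energy rho u <= (rho ^- 2)%:E * energy rho g)%E.
Proof.
move=> rho0 ug; have [[mu _] g2 _] := ug.
have [v vg] := primitive_exists ip Hip rho g rho0 g2.
have vd := primitive_has_deriv rho g v rho0 g2 vg; have [[mv _] _ _] := vd.
rewrite (ae_energy_eq rho u v)//; first exact: (primitive_energy_le ip Hip).
apply: aeq_before_forall => a.
apply: (deriv_eq_before rho u g v g) => //.
exact: aeW.
Qed.

End WeakDerivative.

(** * Completeness and fixed points *)

Section Completeness.
Context {R : realType} {H : completeNormedModType R}.
Implicit Types (rho : R) (f g : R -> H).

(** Stated for an abstract extended distance, since it serves both the norm of [H] at a fixed time
    and the weighted norm. *)
Lemma geometric_dist_le (d : nat -> nat -> \bar R) (C : R) : 0 <= C ->
  (forall n, d n n = 0%E) ->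
  (forall m n p, (d m p <= d m n + d n p)%E) ->
  (forall n, (d n.+1 n <= (C / 2 ^+ n)%:E)%E) ->
  forall n k, (d (n + k)%N n <= (C / 2 ^+ n * 2)%:E)%E.
Proof.
move=> C0 d0 dt d1 n k.
(* The exact partial sum of the geometric series, which makes the induction close. *)
suff : (d (n + k)%N n <= (C / 2 ^+ n * 2 - C / 2 ^+ (n + k) * 2)%:E)%E.
  move=> /le_trans; apply; rewrite lee_fin lerBlDr lerDl mulr_ge0// divr_ge0//.
elim: k => [|k ih]; first by rewrite addn0 d0 subrr.
apply: le_trans (dt _ (n + k)%N _) _; rewrite addnS.
apply: le_trans (leeD (d1 _) ih) _; rewrite -EFinD lee_fin.
rewrite exprS invfM; set c := (2 ^+ (n + k))^-1.
by lra.
Qed.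

Lemma geometric_cvg (x_ : nat -> H) (C : R) : 0 <= C ->
  (forall n, `|x_ n.+1 - x_ n| <= C / 2 ^+ n) -> cvg (x_ n @[n --> \oo]).
Proof.
move=> C0 xC; apply/cauchy_cvgP/cauchy_exP => e e0.
have dist n k : `|x_ (n + k)%N - x_ n| <= C / 2 ^+ n * 2.
  rewrite -lee_fin; apply: (geometric_dist_le (fun m n => `|x_ m - x_ n|%:E)) => //.
  - by move=> m; rewrite subrr normr0.
  - by move=> m l p; rewrite -EFinD lee_fin ler_distD.
have [N HN] : exists N : nat, C / 2 ^+ N * 2 < e.
  have c0 : C * 2 * 2^-1 ^+ n @[n --> \oo] --> (0 : R).
    rewrite -[X in _ --> X](mulr0 (C * 2)); apply: cvgMr; apply: cvg_expr.
    by rewrite ger0_norm ?invr_ge0// invf_lt1// ltr1n.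
  have /cvgr0Pnorm_lt/(_ _ e0)[N _ HN] := c0; exists N.
  have := HN N (leqnn _); apply: le_lt_trans; apply: le_trans (ler_norm _).
  by rewrite exprVn mulrAC.
exists (x_ N); exists N => // n /= Nn; rewrite -ball_normE /ball_ /= distrC -(subnKC Nn).
exact: le_lt_trans (dist _ _) HN.
Qed.

Lemma limn_einf_le (u : (\bar R)^nat) (c : \bar R) : (forall n, (u n <= c)%E) ->
  (limn_einf u <= c)%E.
Proof.
move=> uc; rewrite limn_einf_lim; apply: lime_le; first exact: is_cvg_einfs.
apply: nearW => n; apply: le_trans (uc n).
by apply: ereal_inf_lbound; exists n => /=.
Qed.

(** Riesz-Fischer. Squared increments decay like [16 ^- n], so their series with weights [4 ^+ n]
    still has a finite integral; where its sum is finite, increments are of order [2 ^- n] and the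
    sequence converges in [H]. Fatou's lemma carries the bounds between terms over to the limit. *)
Lemma L2_complete rho (g_ : nat -> R -> H) (M : R) : 0 <= M ->
  (forall n, inL2 rho (g_ n)) ->
  (forall n, (wnorm rho (fsub (g_ n.+1) (g_ n)) <= (M / 4 ^+ n)%:E)%E) ->
  exists2 g, inL2 rho g &
    forall n, (wnorm rho (fsub g (g_ n)) <= (M / 2 ^+ n * 2)%:E)%E.
Proof.
move=> M0 g2 gM.
have mg n : smeasurable (g_ n) by have [] := g2 n.
pose E n t := (`|fsub (g_ n.+1) (g_ n) t| * expR (- (rho * t))) ^+ 2.
have mE n : measurable_fun setT (fun t => (E n t)%:E).
  by apply: measurable_energy; exact: smeasurable_fsub.
have E0 n t : 0 <= E n t by exact: sqr_ge0.
have energyE n : (\int[leb]_t (E n t)%:E <= ((M / 4 ^+ n) ^+ 2)%:E)%E.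
  have Mn : 0 <= M / 4 ^+ n by rewrite divr_ge0// exprn_ge0.
  rewrite -(@lee_sqrt R) ?lee_fin ?sqr_ge0//.
  by rewrite EFin_expe sqrte_sqr gee0_abs ?lee_fin// -wnormE.
pose S t := (\sum_(n <oo) (4 ^+ n * E n t)%:E)%E.
have mS' n : measurable_fun setT (fun t => (4 ^+ n * E n t)%:E).
  by under eq_fun do rewrite EFinM; exact: measurable_funeM.
have S'0 n t : (0 <= (4 ^+ n * E n t)%:E)%E by rewrite lee_fin mulr_ge0// exprn_ge0.
have iS : leb.-integrable setT S.
  apply/integrableP; split; first by apply: (ge0_emeasurable_sum (h := fun n t => (4 ^+ n * E n t)%:E)).
  under eq_integral do rewrite gee0_abs ?nneseries_ge0//.
  rewrite integral_nneseries//.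
  apply: (@le_lt_trans _ _ (M ^+ 2 * 2)%:E); last exact: ltry.
  apply: lime_le.
    by apply: is_cvg_nneseries => n _ _; apply: integral_ge0.
  apply: nearW => n.
  suff : (\sum_(0 <= i < n) \int[leb]_t (4 ^+ i * E i t)%:E <=
    (M ^+ 2 * 2 - M ^+ 2 * 2 / 2 ^+ n)%:E)%E.
    move=> /le_trans; apply; rewrite lee_fin gerBl divr_ge0 ?exprn_ge0// mulr_ge0//.
    exact: sqr_ge0.
  elim: n => [|n ih]; first by rewrite big_nil expr0 divr1 subrr.
  have step : (\int[leb]_t (4 ^+ n * E n t)%:E <= (4 ^+ n)%:E * ((M / 4 ^+ n) ^+ 2)%:E)%E.
    have p4 : 0 <= 4 ^+ n :> R by rewrite exprn_ge0.
    under eq_integral do rewrite EFinM.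
    have := @ge0_integralZl_EFin _ _ _ leb setT measurableT (fun t => (E n t)%:E)
      (fun t _ => E0 n t) (mE n) _ p4 => ->.
    by apply: lee_wpmul2l; [rewrite lee_fin|exact: energyE].
  rewrite big_nat_recr//=; apply: le_trans (leeD ih step) _.
  rewrite -EFinM -EFinD lee_fin.
  have -> : 4 ^+ n * (M / 4 ^+ n) ^+ 2 = M ^+ 2 / 2 ^+ n / 2 ^+ n.
    have -> : 4 ^+ n = 2 ^+ n * 2 ^+ n :> R by rewrite -exprMn -natrM.
    by field; rewrite expf_neq0.
  have -> : M ^+ 2 * 2 / 2 ^+ n.+1 = M ^+ 2 / 2 ^+ n.
    by rewrite [2 ^+ n.+1]exprS; field; rewrite expf_neq0.
  have : M ^+ 2 / 2 ^+ n / 2 ^+ n <= M ^+ 2 / 2 ^+ n.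
    rewrite ler_piMr ?divr_ge0 ?sqr_ge0 ?exprn_ge0//.
    by rewrite invf_le1 ?exprn_gt0// exprn_ege1// ler1n.
  rewrite (_ : M ^+ 2 * 2 / 2 ^+ n = M ^+ 2 / 2 ^+ n * 2); last by rewrite mulrAC.
  by move: (M ^+ 2 / 2 ^+ n / 2 ^+ n) (M ^+ 2 / 2 ^+ n) => b a; lra.
have [N [mN N0 SN]] := integrable_ae measurableT iS.
(* Zero on the exceptional null set, so that the limit exists at every [t], as [smeasurable_cvg]
   requires. *)
pose h n t : H := if t \in N then 0 else g_ n t.
have mh n : smeasurable (h n).
  by apply: smeasurable_if => //; exact: smeasurable_cst.
have hg n : aeq (h n) (g_ n).
  exists N; split => // t /= ht; apply: contrapT => tN; apply: ht.
  by rewrite /h memNset.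
have hcvg t : cvg (h n t @[n --> \oo]).
  have [tN|tN] := pselect (N t).
    rewrite (_ : (fun n => h n t) = cst 0); first exact: is_cvg_cst.
    by apply/funext => n; rewrite /h mem_set.
  rewrite (_ : (fun n => h n t) = g_^~ t); last first.
    by apply/funext => n; rewrite /h memNset.
  have Sfin : S t \is a fin_num.
    by apply: contrapT => nS; apply: tN; apply: SN => /= /(_ I).
  pose c := fine (S t); have c0 : 0 <= c by rewrite fine_ge0// nneseries_ge0.
  have Ec n : 4 ^+ n * E n t <= c.
    rewrite -lee_fin fineK//; apply: (@le_trans _ _ (\sum_(0 <= i < n.+1) (4 ^+ i * E i t)%:E)%E).
      rewrite big_nat_recr//= leeDr//; exact: sume_ge0.
    by apply: nneseries_lim_ge => i _ _.
  apply: (@geometric_cvg _ (Num.sqrt c * expR (rho * t))).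
    by rewrite mulr_ge0// expR_ge0.
  move=> n; rewrite -ler_sqr ?nnegrE ?divr_ge0 ?mulr_ge0 ?expR_ge0 ?exprn_ge0//.
  have := Ec n; rewrite /E /fsub expRN => le.
  have e0 : 0 < expR (rho * t) by exact: expR_gt0.
  rewrite !exprMn sqr_sqrtr// exprVn -exprM mulnC exprM.
  have -> : 2 ^+ 2 = 4 :> R by rewrite -natrX.
  rewrite ler_pdivlMr ?exprn_gt0// -ler_pdivrMr ?exprn_gt0//.
  by apply: le_trans le; rewrite exprMn exprVn mulrA (mulrC (4 ^+ n)).
pose g t := lim (h n t @[n --> \oo]).
have mgl : smeasurable g by apply: (smeasurable_cvg h).
have gh n : (wnorm rho (fsub g (h n)) <= (M / 2 ^+ n * 2)%:E)%E.
  have B0 : 0 <= M / 2 ^+ n * 2 by rewrite mulr_ge0// divr_ge0// exprn_ge0.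
  have dist k : (energy rho (fsub (h (n + k)%N) (h n)) <= ((M / 2 ^+ n * 2) ^+ 2)%:E)%E.
    rewrite -(@lee_sqrt R) ?lee_fin ?sqr_ge0// EFin_expe sqrte_sqr gee0_abs ?lee_fin//.
    rewrite -wnormE; apply: (geometric_dist_le (fun m n => wnorm rho (fsub (h m) (h n)))) => //.
    - move=> m; rewrite wnormE /energy; under eq_integral do rewrite /fsub subrr normr0 mul0r expr0n.
      by rewrite integral0 sqrte0.
    - by move=> m l p; exact: wnorm_triangle.
    - move=> m; rewrite (aeq_wnorm rho _ _ (g_ m.+1) (g_ m))//.
      apply: le_trans (gM m) _; rewrite lee_fin ler_wpM2l// lef_pV2 ?posrE ?exprn_gt0//.
      by rewrite lerXn2r ?nnegrE// ler_nat.
  rewrite wnormE -(gee0_abs (_ : (0 <= (M / 2 ^+ n * 2)%:E)%E)) ?lee_fin// -sqrte_sqr.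
  rewrite -EFin_expe lee_sqrt ?lee_fin ?sqr_ge0//.
  pose F k t := ((`|fsub (h (n + k)%N) (h n) t| * expR (- (rho * t))) ^+ 2)%:E.
  apply: (@le_trans _ _ (limn_einf (fun k => \int[leb]_t F k t)%E)); last first.
    by apply: limn_einf_le => k; exact: dist.
  have -> : energy rho (fsub g (h n)) = (\int[leb]_t limn_einf (F^~ t))%E; last first.
    apply: fatou => // [k|k t _]; last by rewrite lee_fin sqr_ge0.
    by apply: measurable_energy; exact: smeasurable_fsub.
  apply: eq_integral => t _; apply/esym.
  have Fc : F k t @[k --> \oo] --> ((`|fsub g (h n) t| * expR (- (rho * t))) ^+ 2)%:E.
    apply: cvg_EFin; first exact: nearW.
    rewrite /= !expr2.
    have c1 : `|fsub (h (n + k)%N) (h n) t| * expR (- (rho * t)) @[k --> \oo] -->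
       `|fsub g (h n) t| * expR (- (rho * t)).
      apply: cvgMl; apply: cvg_norm; apply: cvgB; last exact: cvg_cst.
      have hc : h k t @[k --> \oo] --> g t := hcvg t.
      rewrite (_ : (fun k => h (n + k)%N t) = (fun k => h (k + n)%N t)).
        by move: hc; rewrite -(cvg_shiftn n).
      by apply/funext => k; rewrite addnC.
    exact: cvgM.
  by have [-> _] := cvg_limn_einf_sup Fc.
exists g.
  split => //.
  have f0 : fsub g (fun=> 0) = g by apply/funext => t; rewrite /fsub subr0.
  have h0 : inL2 rho (h 0%N) by apply: inL2_aeq (g2 0%N) => //; apply: ae_imply (hg 0%N) => t ->.
  have m0 := smeasurable_cst (0 : H).
  rewrite -f0; apply: le_lt_trans (wnorm_triangle rho g (h 0%N) _ mgl (mh _) m0) _.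
  rewrite lte_add_pinfty//; first by apply: le_lt_trans (gh 0%N) (ltry _).
  have -> : fsub (h 0%N) (fun=> 0) = h 0%N by apply/funext => t; rewrite /fsub subr0.
  by case: h0.
by move=> n; rewrite -(aeq_wnorm rho g (h n))//; exact: aeW.
Qed.

Lemma L2_fixpoint rho (T : (R -> H) -> R -> H) :
  (forall f, inL2 rho f -> inL2 rho (T f)) ->
  (forall f g, inL2 rho f -> inL2 rho g ->
    (wnorm rho (fsub (T f) (T g)) <= (4^-1)%:E * wnorm rho (fsub f g))%E) ->
  exists2 g, inL2 rho g & aeq g (T g).
Proof.
move=> T2 Tc.
pose g_ n := iter n T (fun=> 0).
have g2 n : inL2 rho (g_ n).
  by elim: n => [|n ih]; [exact: inL2_0|exact: T2].
have w0 : (wnorm rho (fsub (g_ 1%N) (g_ 0%N)) < +oo)%E.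
  by have [] := inL2_fsub rho _ _ (g2 1%N) (g2 0%N).
pose M := fine (wnorm rho (fsub (g_ 1%N) (g_ 0%N))).
have M0 : 0 <= M by rewrite fine_ge0// wnorm_ge0.
have gM n : (wnorm rho (fsub (g_ n.+1) (g_ n)) <= (M / 4 ^+ n)%:E)%E.
  elim: n => [|n ih].
    by rewrite expr0 divr1 /M fineK// ge0_fin_numE// wnorm_ge0.
  apply: le_trans (Tc _ _ (g2 n.+1) (g2 n)) _.
  apply: le_trans (lee_wpmul2l _ ih) _; first by rewrite lee_fin invr_ge0.
  by rewrite -EFinM lee_fin exprS invfM mulrCA.
have [g gL2 gn] := L2_complete rho g_ M M0 g2 gM.
exists g => //; have mg : smeasurable g by case: gL2.
have mT : smeasurable (T g) by case: (T2 _ gL2).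
apply: (wnorm0_aeq rho) => //; apply/eqP; rewrite eq_le wnorm_ge0 andbT.
apply/lee_addgt0Pr => e e0; rewrite add0e.
(* Two errors of this size: from [g] to the iterate [g_ n.+1], and from that iterate, which is
   [T (g_ n)], to [T g]. *)
have [n ne] : exists n : nat, M / 2 ^+ n * 2 * 2 <= e.
  have c0 : M * 2 * 2 * 2^-1 ^+ n @[n --> \oo] --> (0 : R).
    rewrite -[X in _ --> X](mulr0 (M * 2 * 2)); apply: cvgMr; apply: cvg_expr.
    by rewrite ger0_norm ?invr_ge0// invf_lt1// ltr1n.
  have /cvgr0Pnorm_lt/(_ _ e0)[N _ HN] := c0; exists N.
  have := HN N (leqnn _) => /ltW; apply: le_trans; apply: le_trans (ler_norm _).
  by rewrite exprVn le_eqVlt; apply/orP; left; apply/eqP; ring.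
have mgn k : smeasurable (g_ k) by case: (g2 k).
apply: le_trans (wnorm_triangle rho g (g_ n.+1) (T g) mg (mgn _) mT) _.
have h1 : (wnorm rho (fsub g (g_ n.+1)) <= (M / 2 ^+ n * 2)%:E)%E.
  apply: le_trans (gn _) _; rewrite lee_fin ler_wpM2r// ler_wpM2l//.
  by rewrite lef_pV2 ?posrE ?exprn_gt0// exprS ler_peMl ?exprn_ge0// ler1n.
have h2 : (wnorm rho (fsub (g_ n.+1) (T g)) <= (M / 2 ^+ n * 2)%:E)%E.
  apply: le_trans (Tc _ _ (g2 n) gL2) _; rewrite wnorm_fsubC.
  apply: le_trans (gn n); rewrite -[leRHS]mul1e; apply: lee_wpmul2r.
    exact: wnorm_ge0.
  by rewrite lee_fin invf_le1// ler1n.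
apply: le_trans (leeD h1 h2) _; rewrite -EFinD lee_fin; apply: le_trans ne.
by set a := M / 2 ^+ n * 2; lra.
Qed.

End Completeness.

(** * Causality *)

Section Causality.
Context {R : realType} {H : normedModType R}.
Implicit Types (rho r n a b : R) (f g : R -> H).

Lemma energyD_ge0 rho f g : (0 <= energy rho f + energy rho g)%E.
Proof. by apply: adde_ge0; exact: energy_ge0. Qed.

Definition cut a f t : H := if t \in `]-oo, a[%classic then f t else 0.

Lemma smeasurable_cut a f : smeasurable f -> smeasurable (cut a f).
Proof. by move=> mf; apply: smeasurable_if => //; exact: smeasurable_cst. Qed.

Lemma cut_fsub a f g : fsub (cut a f) (cut a g) = cut a (fsub f g).
Proof. by apply/funext => t; rewrite /fsub /cut; case: ifPn; rewrite ?subr0. Qed.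

Lemma wnorm_cut_le rho a f : smeasurable f -> (wnorm rho (cut a f) <= wnorm rho f)%E.
Proof.
move=> mf; rewrite !wnormE lee_sqrt ?energy_ge0//.
apply: energy_le => //; first exact: smeasurable_cut.
by move=> t; rewrite /cut; case: ifPn => // _; rewrite normr0.
Qed.

Lemma aeq_beforeE a f g : aeq_before a f g <-> aeq (cut a f) (cut a g).
Proof.
split; apply: ae_imply => t fg.
  rewrite /cut; case: ifPn => //; rewrite inE /= in_itv /= => ta; exact: fg.
by move=> ta; move: fg; rewrite /cut mem_set.
Qed.

(** * Comparison of exponential weights *)

Lemma ae_energy_le (c r r' : R) f g : 0 <= c -> smeasurable f -> smeasurable g ->
  {ae leb, forall t, `|f t| * expR (- (r * t)) <= c * (`|g t| * expR (- (r' * t)))} ->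
  (energy r f <= (c ^+ 2)%:E * energy r' g)%E.
Proof.
move=> c0 mf mg fg; rewrite /energy -ge0_integralZl_EFin ?sqr_ge0//; last exact: measurable_energy.
apply: ae_ge0_le_integral => //.
- exact: measurable_energy.
- by move=> t _; rewrite -EFinM lee_fin mulr_ge0 ?sqr_ge0.
- by apply: measurable_funeM; exact: measurable_energy.
- apply: ae_imply fg => t le _; rewrite -EFinM lee_fin -exprMn ler_sqr ?nnegrE ?mulr_ge0 ?expR_ge0//.
Qed.

(** The additional weight [expR (- n t)] is at most [expR (- n a)] where [f] lives. Together with
    the opposite bound before some [b < a] this produces the vanishing ratio
    [expR (- 2 n (a - b))]. *)
Lemma energy_after_le r n a f : 0 <= n -> smeasurable f -> {ae leb, forall t, t < a -> f t = 0} ->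
  (energy (r + n) f <= (expR (- (n * a)) ^+ 2)%:E * energy r f)%E.
Proof.
move=> n0 mf f0; apply: (ae_energy_le (expR (- (n * a)))) => //.
apply: ae_imply f0 => t ft; have [/ft ->|at0] := ltP t a; first by rewrite normr0 !mul0r mulr0.
rewrite mulrCA ler_wpM2l// -expRD ler_expR.
have : n * a <= n * t by rewrite ler_wpM2l.
lra.
Qed.

Lemma energy_cut_le r n b f : 0 <= n -> smeasurable f ->
  (energy r (cut b f) <= (expR (n * b) ^+ 2)%:E * energy (r + n) f)%E.
Proof.
move=> n0 mf; apply: (ae_energy_le (expR (n * b))) => //; first exact: smeasurable_cut.
apply/aeW => t; rewrite /cut; case: ifPn => [|_]; last first.
  by rewrite normr0 mul0r !mulr_ge0 ?expR_ge0.
rewrite inE /= in_itv /= => tb.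
rewrite mulrCA ler_wpM2l// -expRD ler_expR.
have : n * t <= n * b by rewrite ler_wpM2l// ltW.
lra.
Qed.

Lemma sqrte_le_scale (C : R) (x y : \bar R) : 0 <= C -> (0 <= x)%E -> (0 <= y)%E ->
  (sqrte x <= C%:E * sqrte y)%E = (x <= (C ^+ 2)%:E * y)%E.
Proof.
move=> C0 x0 y0; have -> : (C%:E * sqrte y = sqrte ((C ^+ 2)%:E * y))%E.
  by rewrite sqrteM ?lee_fin ?sqr_ge0// EFin_expe sqrte_sqr gee0_abs// lee_fin.
by rewrite lee_sqrt// mule_ge0// lee_fin sqr_ge0.
Qed.

Lemma ereal_le_exp_eq0 (x : \bar R) (c d : R) : (0 <= x)%E -> 0 <= c -> 0 < d ->
  (forall n : nat, (x <= (c * expR (- (n%:R * d)))%:E)%E) -> x = 0%E.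
Proof.
move=> x0 c0 d0 xc; apply/eqP; rewrite eq_le x0 andbT.
apply/lee_addgt0Pr => e e0; rewrite add0e.
have ed0 : 0 < e * d by rewrite mulr_gt0.
pose n := Num.bound (c / (e * d)).
have cn : c / (e * d) < n%:R by apply: archi_boundP; rewrite divr_ge0// ltW.
apply: le_trans (xc n) _; rewrite lee_fin expRN ler_pdivrMr ?expR_gt0//.
have h : 1 + n%:R * d <= expR (n%:R * d) by exact: expR_ge1Dx.
apply: (@le_trans _ _ (e * (1 + n%:R * d))); last by rewrite ler_wpM2l// ltW.
move: cn; rewrite ltr_pdivrMr// => cn.
by move: (n%:R) cn => N cn; nra.
Qed.

Variables (C rho0 : R) (C_gt0 : 0 < C) (rho0_gt0 : 0 < rho0).
Variable Phi : (R -> H) -> (R -> H) -> (R -> H).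
Hypothesis Phi_dom : forall f g, inL2pairall f g -> inL2all (Phi f g).
Hypothesis Phi_lip : forall rho, rho0 < rho -> forall f g f' g',
  inL2pairall f g -> inL2pairall f' g' ->
  (wnorm rho (fsub (Phi f g) (Phi f' g')) <= C%:E * wnorm2 rho (fsub f f') (fsub g g'))%E.

Lemma inL2pairallE f g : inL2pairall f g <-> inL2all f /\ inL2all g.
Proof.
split => [fg|[f2 g2] eta eta0]; last by apply/inL2pairE; split; [exact: f2|exact: g2].
by split => eta eta0; have /inL2pairE[] := fg eta eta0.
Qed.

Lemma inL2all_smeasurable f : inL2all f -> smeasurable f.
Proof. by move=> /(_ 1 ltr01) []. Qed.

(* The Lipschitz constant does not depend on [rho]; as [rho] grows, the weight
   forces [Phi f g] to ignore what happens after time [a]. *)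
Lemma Phi_causal a f g f' g' : inL2pairall f g -> inL2pairall f' g' ->
  aeq_before a f f' -> aeq_before a g g' -> aeq_before a (Phi f g) (Phi f' g').
Proof.
move=> fg fg' ff gg.
have [f2 g2] := (inL2pairallE _ _).1 fg; have [f2' g2'] := (inL2pairallE _ _).1 fg'.
have P2 := Phi_dom _ _ fg; have P2' := Phi_dom _ _ fg'.
have mf := inL2all_smeasurable _ f2; have mg := inL2all_smeasurable _ g2.
have mf' := inL2all_smeasurable _ f2'; have mg' := inL2all_smeasurable _ g2'.
have mP := inL2all_smeasurable _ P2; have mP' := inL2all_smeasurable _ P2'.
have mff := smeasurable_fsub _ _ mf mf'; have mgg := smeasurable_fsub _ _ mg mg'.
have mD := smeasurable_fsub _ _ mP mP'.
have r0 : 0 < rho0 + 1 by rewrite addr_gt0.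
(* Base weight: every [r + n] exceeds [rho0], so the Lipschitz bound holds at all of them with the
   same [C]. *)
pose r := rho0 + 1.
have ef : (energy r (fsub f f') < +oo)%E.
  by have [_] := (inL2E _ _).1 (inL2_fsub r _ _ (f2 _ r0) (f2' _ r0)).
have eg : (energy r (fsub g g') < +oo)%E.
  by have [_] := (inL2E _ _).1 (inL2_fsub r _ _ (g2 _ r0) (g2' _ r0)).
pose m := fine (energy r (fsub f f') + energy r (fsub g g')).
have mE : (energy r (fsub f f') + energy r (fsub g g'))%E = m%:E.
  by rewrite /m fineK// ge0_fin_numE ?energyD_ge0 ?energy_ge0// lte_add_pinfty.
have m0 : 0 <= m by rewrite fine_ge0// energyD_ge0.
have before0 (h h' : R -> H) : aeq_before a h h' -> {ae leb, forall t, t < a -> fsub h h' t = 0}.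
  by apply: ae_imply => t hh /hh; rewrite /fsub => ->; rewrite subrr.
(* The gap [a - b] is what makes the bound decay in [n]; at [b = a] it would stay constant. The
   times [a - 1 / (n + 1)] then exhaust [t < a]. *)
have cut0 b : b < a -> {ae leb, forall t, t < b -> fsub (Phi f g) (Phi f' g') t = 0}.
  move=> ba.
  have E0 : energy r (cut b (fsub (Phi f g) (Phi f' g'))) = 0%E.
    apply: (ereal_le_exp_eq0 _ (C ^+ 2 * m) (2 * (a - b))).
    - exact: energy_ge0.
    - by rewrite mulr_ge0 ?sqr_ge0.
    - by rewrite mulr_gt0// subr_gt0.
    move=> n; have n0 : (0 : R) <= n%:R by [].
    apply: le_trans (energy_cut_le r n%:R b _ n0 mD) _.
    have rn : rho0 < r + n%:R by rewrite ltr_wpDr// /r ltrDl.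
    have := Phi_lip _ rn _ _ _ _ fg fg'.
    rewrite wnormE wnorm2E// sqrte_le_scale ?energyD_ge0 ?energy_ge0 ?(ltW C_gt0)// => PL.
    apply: le_trans (lee_wpmul2l _ PL) _; first by rewrite lee_fin sqr_ge0.
    have after : (energy (r + n%:R) (fsub f f') + energy (r + n%:R) (fsub g g') <=
        (expR (- (n%:R * a)) ^+ 2)%:E * m%:E)%E.
      rewrite -mE ge0_muleDr ?energy_ge0//; apply: leeD; apply: energy_after_le => //;
        exact: before0.
    apply: le_trans (lee_wpmul2l _ (lee_wpmul2l _ after)) _; rewrite ?lee_fin ?sqr_ge0//.
    rewrite le_eqVlt; apply/orP; left; apply/eqP.
    have -> : expR (- (n%:R * (2 * (a - b)))) = expR (n%:R * b) ^+ 2 * expR (- (n%:R * a)) ^+ 2.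
      by rewrite !expr2 -!expRD; congr expR; ring.
    by ring.
  have := energy0_ae r _ (smeasurable_cut b _ mD) E0; apply: ae_imply => t ct tb.
  by move: ct; rewrite /cut mem_set.
have lt_a (n : nat) : a - n.+1%:R^-1 < a by rewrite gtrBl invr_gt0.
have := ae_foralln (fun n : nat => cut0 _ (lt_a n)).
apply: ae_imply => t H0 ta; apply/eqP; rewrite -subr_eq0; apply/eqP.
have at0 : 0 < a - t by rewrite subr_gt0.
have [N _ HN] := near_infty_natSinv_lt (PosNum at0).
have := HN N (leqnn _); rewrite /= => h; apply: (H0 N); move: h.
by move: (N.+1%:R^-1) => x; lra.
Qed.

(** * Passage from [Phi] to its continuous extension *)

Variables (rho : R) (rho_gt : rho0 < rho).
Variable Psi : (R -> H) -> (R -> H) -> (R -> H).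
Hypothesis ext : cont_ext rho Phi Psi.

Lemma inL2pairall_truncate (n : nat) f g : inL2pair rho f g ->
  inL2pairall (truncate n f) (truncate n g).
Proof.
by move=> /inL2pairE[f2 g2]; apply/inL2pairallE; split; apply: (inL2all_truncate rho).
Qed.

Lemma inL2pair_truncate (n : nat) f g : inL2pair rho f g -> inL2pair rho (truncate n f) (truncate n g).
Proof. by move=> /inL2pairE[f2 g2]; apply/inL2pairE; split; exact: inL2_truncate. Qed.

Lemma ext_truncate_cvg f g (e : R) : inL2pair rho f g -> 0 < e -> exists N, forall n : nat, (N <= n)%N ->
  (wnorm rho (fsub (Psi (truncate n f) (truncate n g)) (Psi f g)) < e%:E)%E.
Proof.
move=> fg e0; have [_ _ cont] := ext; have [d d0 dP] := cont f g fg e e0.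
have [f2 g2] := (inL2pairE _ _ _).1 fg; have [mf _] := f2; have [mg _] := g2.
have d20 : 0 < d ^+ 2 / 2 by rewrite divr_gt0 ?exprn_gt0.
have [N1 HN1] := wnorm_truncate_cvg rho f f2 _ d20.
have [N2 HN2] := wnorm_truncate_cvg rho g g2 _ d20.
exists (maxn N1 N2) => n; rewrite geq_max => /andP[n1 n2].
apply: dP; first exact: inL2pair_truncate.
have mt h : smeasurable h -> smeasurable (fsub (truncate n h) h).
  by move=> mh; apply: smeasurable_fsub => //; exact: smeasurable_truncate.
rewrite wnorm2E; [|exact: mt|exact: mt].
have lt : (energy rho (fsub (truncate n f) f) + energy rho (fsub (truncate n g) g) < (d ^+ 2)%:E)%E.
  by rewrite (splitr (d ^+ 2)) EFinD; apply: lteD; [exact: HN1|exact: HN2].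
rewrite ltNge; apply/negP => le; move: lt; rewrite ltNge => /negP; apply.
rewrite -(@lee_sqrt R) ?energyD_ge0 ?energy_ge0//.
by rewrite EFin_expe sqrte_sqr gee0_abs// lee_fin ltW.
Qed.

Lemma ext_smeasurable f g : inL2pair rho f g -> smeasurable (Psi f g).
Proof. by have [E _ _] := ext; move=> /E[]. Qed.

(** On truncations [Psi] is [Phi] almost everywhere, and truncating does not increase the norm on
    the right; continuity of [Psi] removes the truncation at the cost of an arbitrary [e]. *)
Lemma ext_lip f g f' g' : inL2pair rho f g -> inL2pair rho f' g' ->
  (wnorm rho (fsub (Psi f g) (Psi f' g')) <= C%:E * wnorm2 rho (fsub f f') (fsub g g'))%E.
Proof.
move=> fg fg'; have [f2 g2] := (inL2pairE _ _ _).1 fg; have [f2' g2'] := (inL2pairE _ _ _).1 fg'.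
have [mf _] := f2; have [mg _] := g2; have [mf' _] := f2'; have [mg' _] := g2'.
apply/lee_addgt0Pr => e e0.
have e20 : 0 < e / 2 by rewrite divr_gt0.
have [N1 HN1] := ext_truncate_cvg f g _ fg e20.
have [N2 HN2] := ext_truncate_cvg f' g' _ fg' e20.
pose n := maxn N1 N2.
have h1 := HN1 n (leq_maxl _ _); have h2 := HN2 n (leq_maxr _ _).
have fgn := inL2pairall_truncate n _ _ fg; have fgn' := inL2pairall_truncate n _ _ fg'.
have mP := ext_smeasurable _ _ fg; have mP' := ext_smeasurable _ _ fg'.
have mPn := ext_smeasurable _ _ (inL2pair_truncate n _ _ fg).
have mPn' := ext_smeasurable _ _ (inL2pair_truncate n _ _ fg').
have mid : (wnorm rho (fsub (Psi (truncate n f) (truncate n g)) (Psi (truncate n f') (truncate n g')))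
   <= C%:E * wnorm2 rho (fsub f f') (fsub g g'))%E.
  have [_ agree _] := ext.
  rewrite (aeq_wnorm rho _ _ (Phi (truncate n f) (truncate n g)) (Phi (truncate n f') (truncate n g')))//;
    first last.
  - exact: agree.
  - exact: agree.
  - exact: inL2all_smeasurable (Phi_dom _ _ fgn').
  - exact: inL2all_smeasurable (Phi_dom _ _ fgn).
  apply: le_trans (Phi_lip _ rho_gt _ _ _ _ fgn fgn') _.
  apply: lee_wpmul2l; first by rewrite lee_fin ltW.
  rewrite !truncate_fsub !wnorm2E; try by [exact: smeasurable_fsub|
    apply: smeasurable_truncate; exact: smeasurable_fsub].
  rewrite lee_sqrt ?energyD_ge0 ?energy_ge0//.
  by apply: leeD; apply: energy_truncate_le; exact: smeasurable_fsub.
apply: le_trans (wnorm_triangle rho _ (Psi (truncate n f) (truncate n g)) _ mP mPn mP') _.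
apply: le_trans (leeD (lexx _) (wnorm_triangle rho _ (Psi (truncate n f') (truncate n g')) _ mPn mPn' mP')) _.
rewrite addeCA (splitr e) EFinD; apply: leeD => //.
by apply: leeD; apply/ltW => //; rewrite wnorm_fsubC.
Qed.

Lemma ext_causal a f g f' g' : inL2pair rho f g -> inL2pair rho f' g' ->
  aeq_before a f f' -> aeq_before a g g' -> aeq_before a (Psi f g) (Psi f' g').
Proof.
move=> fg fg' ff gg.
have mP := ext_smeasurable _ _ fg; have mP' := ext_smeasurable _ _ fg'.
apply/aeq_beforeE; apply: (wnorm0_aeq rho); [exact: smeasurable_cut|exact: smeasurable_cut|].
apply/eqP; rewrite eq_le wnorm_ge0 andbT; apply/lee_addgt0Pr => e e0; rewrite add0e.
have e20 : 0 < e / 2 by rewrite divr_gt0.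
have [N1 HN1] := ext_truncate_cvg f g _ fg e20.
have [N2 HN2] := ext_truncate_cvg f' g' _ fg' e20.
pose n := maxn N1 N2.
have h1 := HN1 n (leq_maxl _ _); have h2 := HN2 n (leq_maxr _ _).
have fgn := inL2pairall_truncate n _ _ fg; have fgn' := inL2pairall_truncate n _ _ fg'.
have mPn := ext_smeasurable _ _ (inL2pair_truncate n _ _ fg).
have mPn' := ext_smeasurable _ _ (inL2pair_truncate n _ _ fg').
have [_ agree _] := ext.
have tr (h h' : R -> H) : aeq_before a h h' -> aeq_before a (truncate n h) (truncate n h').
  by apply: ae_imply => t hh ta; rewrite /truncate; case: ifP => // _; exact: hh.
(* Once cut at [a] the two approximants coincide, so only the two approximation errors [e / 2]
   remain. *)
have eqn : aeq (cut a (Psi (truncate n f) (truncate n g))) (cut a (Psi (truncate n f') (truncate n g'))).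
  apply/aeq_beforeE.
  have := Phi_causal a _ _ _ _ fgn fgn' (tr _ _ ff) (tr _ _ gg).
  move=> /(ae_imply2 _ _ _ (fun t P Q => conj P Q) (agree _ _ fgn)).
  move=> /(ae_imply2 _ _ _ (fun t P Q => conj P Q) (agree _ _ fgn')).
  by apply: ae_imply => t [e1 [e2 e3]] ta; rewrite e1 e2 e3.
apply: le_trans (wnorm_triangle rho _ (cut a (Psi (truncate n f) (truncate n g))) _ _ _ _) _;
  try exact: smeasurable_cut.
rewrite [X in (_ + X <= _)%E](aeq_wnorm rho _ _ (cut a (Psi (truncate n f') (truncate n g'))) (cut a (Psi f' g')));
  try exact: smeasurable_cut; [|exact: eqn|exact: aeW].
rewrite !cut_fsub (splitr e) EFinD; apply: leeD.
  apply: le_trans (wnorm_cut_le _ _ _ _) _; first exact: smeasurable_fsub.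
  by rewrite wnorm_fsubC; exact: ltW.
apply: le_trans (wnorm_cut_le _ _ _ _) _; first exact: smeasurable_fsub.
exact: ltW.
Qed.

End Causality.

(** * The delay equation *)

Section Contraction.
Context {R : realType} {H : completeNormedModType R} (ip : H -> H -> R).
Hypothesis Hip : is_inner_product ip.
Variables (C rho0 : R) (C_gt0 : 0 < C) (rho0_gt0 : 0 < rho0).
Variable Phi : (R -> H) -> (R -> H) -> (R -> H).
Hypothesis Phi_dom : forall f g, inL2pairall f g -> inL2all (Phi f g).
Hypothesis Phi_lip : forall rho, rho0 < rho -> forall f g f' g',
  inL2pairall f g -> inL2pairall f' g' ->
  (wnorm rho (fsub (Phi f g) (Phi f' g')) <= C%:E * wnorm2 rho (fsub f f') (fsub g g'))%E.
Variables (alpha alphainv beta betainv : R -> R).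
Hypotheses (alphaK : cancel alpha alphainv) (alphainvK : cancel alphainv alpha).
Hypotheses (betaK : cancel beta betainv) (betainvK : cancel betainv beta).
Variables (La Lb eps : R) (La_gt0 : 0 < La) (Lb_gt0 : 0 < Lb) (eps_gt0 : 0 < eps).
Hypothesis alpha_lip : forall x y, `|alpha x - alpha y| <= La * `|x - y|.
Hypothesis beta_lip : forall x y, `|beta x - beta y| <= Lb * `|x - y|.
Hypothesis alpha_ge : forall s, s <= alpha s.
Hypothesis beta_ge : forall s, s + eps <= beta s.

Let beta_ge0 s : s <= beta s.
Proof. by apply: le_trans (beta_ge s); rewrite lerDl ltW. Qed.

(** The first entry gives [rho > rho0] and [rho >= 1], so that [rho ^- 2 <= rho^-1]. In the second,
    [16] is the inverse square of the rate [1 / 4], and [Lb / (2 eps)] comes from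
    [expR (- x) <= 1 / x] at [x = 2 rho eps]; the condition thus becomes linear in [rho]. *)
Definition threshold : R := Num.max (rho0 + 1) (16 * C ^+ 2 * (La + Lb / (2 * eps))).

Lemma contraction_factor_le rho : threshold <= rho ->
  C ^+ 2 * (La * rho ^- 2 + Lb * expR (- (2 * (rho * eps)))) <= (4^-1) ^+ 2.
Proof.
rewrite /threshold ge_max => /andP[rho1 rhoC].
have r1 : 1 <= rho by apply: le_trans rho1; rewrite lerDr ltW.
have r0 : 0 < rho by rewrite (lt_le_trans ltr01).
have ha : La * rho ^- 2 <= La * rho^-1.
  rewrite ler_wpM2l ?(ltW La_gt0)// lef_pV2 ?posrE ?exprn_gt0//.
  by rewrite expr2 ler_peMr// ltW.
have hb : Lb * expR (- (2 * (rho * eps))) <= Lb / (2 * eps) * rho^-1.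
  rewrite -mulrA ler_wpM2l ?(ltW Lb_gt0)// expRN -invfM lef_pV2 ?posrE ?expR_gt0 ?mulr_gt0//.
  apply: le_trans (expR_ge1Dx _).
  by rewrite (_ : 2 * eps * rho = 2 * (rho * eps)) ?lerDr//; ring.
apply: (@le_trans _ _ (C ^+ 2 * ((La + Lb / (2 * eps)) * rho^-1))).
  by rewrite ler_wpM2l ?sqr_ge0// [leRHS]mulrDl lerD.
rewrite mulrA ler_pdivrMr// exprVn -natrX.
rewrite -ler_pdivrMl ?invr_gt0// invrK.
by rewrite mulrA.
Qed.

Variables (rho : R) (rho_ge : threshold <= rho).
Variable Psi : (R -> H) -> (R -> H) -> (R -> H).
Hypothesis ext : cont_ext rho Phi Psi.

Let rho_gt : rho0 < rho.
Proof.
by apply: lt_le_trans rho_ge; rewrite /threshold lt_max ltrDl ltr01.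
Qed.

Let rho_gt0 : 0 < rho.
Proof. exact: lt_trans rho_gt. Qed.

Definition delayed u g := Psi (u \o alphainv) (g \o betainv).

Lemma inL2pair_delay (u g : R -> H) : inL2 rho u -> inL2 rho g ->
  inL2pair rho (u \o alphainv) (g \o betainv).
Proof.
move=> u2 g2; apply/inL2pairE; split.
  exact: (inL2_comp_inv alpha alphainv alphaK alphainvK alpha_ge La La_gt0 alpha_lip).
exact: (inL2_comp_inv beta betainv betaK betainvK beta_ge0 Lb Lb_gt0 beta_lip).
Qed.

Lemma delayed_contraction u g v k : has_deriv ip rho u g -> has_deriv ip rho v k ->
  (wnorm rho (fsub (delayed u g) (delayed v k)) <= (4^-1)%:E * wnorm rho (fsub g k))%E.
Proof.
move=> ug vk; have [u2 g2 _] := ug; have [v2 k2 _] := vk.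
have uvd := has_deriv_fsub ip Hip rho u g v k rho_gt0 ug vk.
have [[muv _] [mgk _] _] := uvd.
apply: le_trans (ext_lip C rho0 C_gt0 Phi Phi_dom Phi_lip rho rho_gt Psi ext _ _ _ _
  (inL2pair_delay u g u2 g2) (inL2pair_delay v k v2 k2)) _.
have -> : fsub (u \o alphainv) (v \o alphainv) = fsub u v \o alphainv by [].
have -> : fsub (g \o betainv) (k \o betainv) = fsub g k \o betainv by [].
have malpha := inv_measurable alpha alphainv alphaK alphainvK alpha_ge La La_gt0 alpha_lip.
have mbeta := inv_measurable beta betainv betaK betainvK beta_ge0 Lb Lb_gt0 beta_lip.
rewrite wnorm2E ?wnormE; [|exact: smeasurable_comp|exact: smeasurable_comp].
set E := energy rho (fsub g k).
(* Composition with [alphainv] is used with [d = 0]; the smallness of this argument comes from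
   integrating [g - k]. *)
have ea : (energy rho (fsub u v \o alphainv) <= (La * rho ^- 2)%:E * E)%E.
  have a0 s : s + 0 <= alpha s by rewrite addr0.
  apply: le_trans (energy_comp_inv_le alpha alphainv alphaK alphainvK alpha_ge La La_gt0
    alpha_lip rho 0 _ rho_gt0 a0 muv) _.
  rewrite !mulr0 oppr0 expR0 mulr1 EFinM -muleA.
  apply: lee_wpmul2l; first by rewrite lee_fin ltW.
  exact: (deriv_energy_le ip Hip).
have eb : (energy rho (fsub g k \o betainv) <= (Lb * expR (- (2 * (rho * eps))))%:E * E)%E.
  exact: (energy_comp_inv_le beta betainv betaK betainvK beta_ge0 Lb Lb_gt0 beta_lip).
have E0 : (0 <= E)%E by exact: energy_ge0.
rewrite -(gee0_abs (_ : (0 <= (4^-1 : R)%:E)%E)) ?lee_fin ?invr_ge0// -sqrte_sqr.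
rewrite -EFin_expe -sqrteM ?lee_fin ?sqr_ge0//.
rewrite -(gee0_abs (_ : (0 <= C%:E)%E)) ?lee_fin ?(ltW C_gt0)// -sqrte_sqr.
rewrite -EFin_expe -sqrteM ?lee_fin ?sqr_ge0//.
rewrite lee_sqrt; last by rewrite mule_ge0// lee_fin sqr_ge0.
apply: le_trans (lee_wpmul2l _ (leeD ea eb)) _; first by rewrite lee_fin sqr_ge0.
rewrite -ge0_muleDl ?lee_fin; first last.
- by rewrite mulr_ge0 ?expR_ge0// ltW.
- by rewrite mulr_ge0 ?(ltW La_gt0)// invr_ge0 exprn_ge0// ltW.
rewrite -EFinD muleA -EFinM; apply: lee_wpmul2r => //.
by rewrite lee_fin contraction_factor_le.
Qed.

Lemma solution_exists : exists u g, has_deriv ip rho u g /\ aeq g (delayed u g).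
Proof.
(* [I] selects a primitive; its value outside the space is an arbitrary default. *)
have /choice[I HI] : forall g, exists u, inL2 rho g -> has_deriv ip rho u g.
  move=> g; have [g2|ng] := pselect (inL2 rho g); last by exists g.
  by have [u ug] := deriv_exists ip Hip rho g rho_gt0 g2; exists u.
have T2 f : inL2 rho f -> inL2 rho (delayed (I f) f).
  move=> f2; have [If2 _ _] := HI f f2; have [E _ _] := ext.
  by apply: E; exact: inL2pair_delay.
have [g g2 gT] := L2_fixpoint rho (fun g => delayed (I g) g) T2
  (fun f f' f2 f2' => delayed_contraction _ _ _ _ (HI f f2) (HI f' f2')).
by exists (I g), g; split => //; exact: HI.
Qed.

Lemma solution_unique u g v k :
  has_deriv ip rho u g -> aeq g (delayed u g) ->
  has_deriv ip rho v k -> aeq k (delayed v k) -> aeq u v.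
Proof.
move=> ug gE vk kE; have [u2 g2 _] := ug; have [v2 k2 _] := vk.
have [mg _] := g2; have [mk _] := k2.
have mP := ext_smeasurable Phi rho Psi ext _ _ (inL2pair_delay u g u2 g2).
have mP' := ext_smeasurable Phi rho Psi ext _ _ (inL2pair_delay v k v2 k2).
have := delayed_contraction u g v k ug vk.
rewrite -(aeq_wnorm rho g k (delayed u g) (delayed v k))// => le.
have [_ gkfin] := inL2_fsub rho g k g2 k2.
have gk0 := wnorm_ge0 rho (fsub g k).
(* Finiteness of the distance matters: [+oo] also satisfies the contraction inequality. *)
have w0 : wnorm rho (fsub g k) = 0%E.
  move: le gkfin gk0; case: (wnorm rho (fsub g k)) => [x| |]//.
  rewrite -EFinM !lee_fin => le _ x0; congr EFin; lra.
have gk := wnorm0_aeq rho g k mg mk w0.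
apply: aeq_before_forall => a; apply: (deriv_eq_before ip Hip rho u g v k) => //.
by apply: ae_imply gk => t ->.
Qed.

Lemma delayed_causal a u g v k : has_deriv ip rho u g -> has_deriv ip rho v k ->
  aeq_before a u v -> aeq_before a (delayed u g) (delayed v k).
Proof.
move=> ug vk uv; have [u2 g2 _] := ug; have [v2 k2 _] := vk.
have gk := eq_deriv_before ip Hip rho u g v k a rho_gt0 ug vk uv.
apply: (ext_causal C rho0 C_gt0 rho0_gt0 Phi Phi_dom Phi_lip rho Psi ext).
- exact: inL2pair_delay.
- exact: inL2pair_delay.
- exact: (aeq_before_comp_inv alpha alphainv alphaK alphainvK alpha_ge La La_gt0 alpha_lip).
- exact: (aeq_before_comp_inv beta betainv betaK betainvK beta_ge0 Lb Lb_gt0 beta_lip).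
Qed.

End Contraction.

(** A function and its derivative travel as a pair linked by [has_deriv]. The operator in the
    causality clause is given by its graph: [w1] is any function whose derivative is the right-hand
    side at [u], and such functions exist by [deriv_exists]. *)
Theorem theorem5p16 (R : realType) (H : completeNormedModType R)
  (ip : H -> H -> R) (Hip : is_inner_product ip)
  (C rho0 : R) (C_gt0 : 0 < C) (rho0_gt0 : 0 < rho0)
  (Phi : (R -> H) -> (R -> H) -> (R -> H))
  (Phi_dom : forall a b, inL2pairall a b -> inL2all (Phi a b))
  (Phi_est : forall rho, rho0 < rho -> exists2 K : R, 0 < K &
      (wnorm rho (Phi (fun=> 0%R) (fun=> 0%R)) <= K%:E)%E /\
      forall a b a' b', inL2pairall a b -> inL2pairall a' b' ->
        (wnorm rho (fsub (Phi a b) (Phi a' b')) <= C%:E * wnorm2 rho (fsub a a') (fsub b b'))%E)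
  (alpha alphainv beta betainv : R -> R)
  (alphaK : cancel alpha alphainv) (alphainvK : cancel alphainv alpha)
  (betaK : cancel beta betainv) (betainvK : cancel betainv beta)
  (alpha_lip : lipschitz alpha) (beta_lip : lipschitz beta)
  (alpha_der : {ae leb, forall t, derivable alpha t 1} /\
     measurable_fun setT (derive1 alpha) /\
     exists M : R, {ae leb, forall t, `|derive1 alpha t| <= M})
  (beta_der : {ae leb, forall t, derivable beta t 1} /\
     measurable_fun setT (derive1 beta) /\
     exists M : R, {ae leb, forall t, `|derive1 beta t| <= M})
  (alpha_ge : forall s, s <= alpha s)
  (beta_ge : exists2 eps0 : R, 0 < eps0 & forall s, s + eps0 <= beta s) :
  exists2 rho1 : R, rho0 < rho1 & forall rho : R, rho1 <= rho ->
    forall Phirho : (R -> H) -> (R -> H) -> (R -> H), cont_ext rho Phi Phirho ->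
      (* existence and uniqueness *)
      (exists u g : R -> H, has_deriv ip rho u g /\
         aeq g (Phirho (u \o alphainv) (g \o betainv))) /\
      (forall u g v k : R -> H,
         has_deriv ip rho u g -> aeq g (Phirho (u \o alphainv) (g \o betainv)) ->
         has_deriv ip rho v k -> aeq k (Phirho (v \o alphainv) (k \o betainv)) ->
         aeq u v) /\
      (* causality of u |-> d^{-1} Phirho (u o alpha^-1, (d u) o beta^-1) *)
      (forall (a : R) (u g v k w1 dw1 w2 dw2 : R -> H),
         has_deriv ip rho u g -> has_deriv ip rho v k ->
         has_deriv ip rho w1 dw1 -> aeq dw1 (Phirho (u \o alphainv) (g \o betainv)) ->
         has_deriv ip rho w2 dw2 -> aeq dw2 (Phirho (v \o alphainv) (k \o betainv)) ->
         aeq_before a u v -> aeq_before a w1 w2).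
Proof.
have [La La0 alip] := lipschitz_bound alpha alpha_lip.
have [Lb Lb0 blip] := lipschitz_bound beta beta_lip.
have [eps eps0 beps] := beta_ge.
have Phi_lip rho : rho0 < rho -> forall f g f' g',
  inL2pairall f g -> inL2pairall f' g' ->
  (wnorm rho (fsub (Phi f g) (Phi f' g')) <= C%:E * wnorm2 rho (fsub f f') (fsub g g'))%E.
  by move=> /Phi_est[K _ [_]].
exists (threshold C rho0 La Lb eps).
  by rewrite /threshold lt_max ltrDl ltr01.
move=> rho rho_ge Psi ext; split; [|split].
- by have [u [g ?]] := solution_exists ip Hip C rho0 C_gt0 rho0_gt0 Phi Phi_dom Phi_lip
    alpha alphainv beta betainv alphaK alphainvK betaK betainvK La Lb eps La0 Lb0 eps0
    alip blip alpha_ge beps rho rho_ge Psi ext; exists u, g.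
- exact: (solution_unique ip Hip C rho0 C_gt0 rho0_gt0 Phi Phi_dom Phi_lip
    alpha alphainv beta betainv alphaK alphainvK betaK betainvK La Lb eps La0 Lb0 eps0
    alip blip alpha_ge beps rho rho_ge Psi ext).
move=> a u g v k w1 dw1 w2 dw2 ug vk w1d dw1E w2d dw2E uv.
have rho_gt0 : 0 < rho.
  by apply: lt_trans rho0_gt0 _; apply: lt_le_trans rho_ge; rewrite /threshold lt_max ltrDl ltr01.
have caus := delayed_causal ip Hip C rho0 C_gt0 rho0_gt0 Phi Phi_dom Phi_lip
    alpha alphainv beta betainv alphaK alphainvK betaK betainvK La Lb eps La0 Lb0 eps0
    alip blip alpha_ge beps rho rho_ge Psi ext a u g v k ug vk uv.
(* Causality of the inverse derivative; it remains to see that [dw1] and [dw2] agree before [a]. *)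
apply: (deriv_eq_before ip Hip rho w1 dw1 w2 dw2 a rho_gt0 w1d w2d).
move: (ae_imply2 _ _ _ (fun t P Q => conj P Q) dw1E (ae_imply2 _ _ _ (fun t P Q => conj P Q) dw2E caus)).
by apply: ae_imply => t [e1 [e2 e3]] ta; rewrite e1 e2; exact: e3.
Qed.
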